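(* Let $E$ be an irreducible, locally finite, infinite directed graph and let $\mathcal A_E$ be the AF subalgebra of the graph $C^*$-algebra $C^*(E)$ generated by the elements $\{s_\alpha s_\beta^*\mid \alpha,\beta\in E^*,\ |\alpha|=|\beta|\}$. Let $\Phi_E:C^*(E)\to C^*(E)$ be the canonical completely positive map $\Phi_E(x)=\sum_{e\in E^1}s_e x s_e^*$, which leaves $\mathcal A_E$ invariant. Then $$ht(\Phi_E|_{\mathcal A_E})\ \leq\ \max\{h_b({}^tE),\,h_b(E)\}.$$
   Context: Graphs. A directed graph is $E=(E^0,E^1,r,s)$ with vertex set $E^0$, edge set $E^1$ and range and source maps $r,s:E^1\to E^0$. It is locally finite if every vertex receives and emits only finitely many edges. A finite path of length $n\ge 1$ is a sequence $\alpha=\alpha_1\cdots\alpha_n$ of edges with $r(\alpha_i)=s(\alpha_{i+1})$; put $s(\alpha)=s(\alpha_1)$, $r(\alpha)=r(\alpha_n)$, $|\alpha|=n$. Vertices are paths of length $0$, with $s(v)=r(v)=v$. $E^n$ is the set of paths of length $n$ and $E^*=\bigcup_{n\ge0}E^n$. $E$ is irreducible if for any two vertices $v,w$ there is a finite path $\alpha$ with $s(\alpha)=v$, $r(\alpha)=w$. ${}^tE$ denotes $E$ with the direction of all edges reversed. Block entropy. For an irreducible graph $E$ and $v\in E^0$, $h_b(E):=\limsup_{n\to\infty}\frac1n\log|\{\alpha\in E^n\mid s(\alpha)=v\}|$; this does not depend on the choice of $v$. Values are extended reals. Graph $C^*$-algebra. $C^*(E)$ is the $C^*$-algebra generated by a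 universal Cuntz-Krieger $E$-family, i.e. mutually orthogonal projections $\{p_v\}_{v\in E^0}$ and partial isometries $\{s_e\}_{e\in E^1}$ with $s_e^*s_e=p_{r(e)}$, $s_es_e^*\le p_{s(e)}$, and $p_v=\sum_{s(e)=v}s_es_e^*$ whenever $0<|s^{-1}(v)|<\infty$. For $\alpha=\alpha_1\cdots\alpha_n$ put $s_\alpha=s_{\alpha_1}\cdots s_{\alpha_n}$, and $s_v=p_v$ for a vertex $v$. One has $\mathcal A_E=\overline{\mathrm{span}}\{s_\alpha s_\beta^*\mid \alpha,\beta\in E^*,|\alpha|=|\beta|\}$. For locally finite $E$ the map $\Phi_E$ is well defined, contractive and completely positive. Topological entropy. Let $A$ be an exact $C^*$-algebra (graph $C^*$-algebras are nuclear, and subalgebras of exact $C^*$-algebras are exact), $\pi:A\to B(H)$ a faithful $*$-representation, and $\Phi:A\to A$ a completely positive (cp) map. Let $CPA(\pi,A)$ be the set of triples $(\phi,\psi,B)$ with $B$ a finite-dimensional $C^*$-algebra and $\phi:A\to B$, $\psi:B\to B(H)$ contractive cp maps. For a finite subset $\omega\subset A$ and $\delta>0$ let $rcp(\omega,\delta)=\inf\{\mathrm{rank}(B)\mid(\phi,\psi,B)\in CPA(\pi,A),\ \|\psi\circ\phi(x)-\pi(x)\|<\delta\text{ for all }x\in\omega\}$, where $\mathrm{rank}(B)$ is the dimension of a maximal abelian subalgebra of $B$; this does not depend on $\pi$. Put $ht(\Phi,\omega,\delta)=\limsup_{n\to\infty}\frac1n\log rcp(\bigcup_{i=0}^{n-1}\Phi^i(\omega),\delta)$,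 $ht(\Phi,\omega)=\sup_{\delta>0}ht(\Phi,\omega,\delta)$, and $ht(\Phi)=\sup_\omega ht(\Phi,\omega)$, the supremum over all finite subsets $\omega$ of $A$. $ht(\Phi_E|_{\mathcal A_E})$ is this quantity for $A=\mathcal A_E$ and $\Phi=\Phi_E|_{\mathcal A_E}$. *)

(* Defs.v *)
From HB Require Import structures.
From mathcomp Require Import all_boot all_order all_algebra finmap.
From mathcomp Require Import complex.
From mathcomp Require Import all_classical all_reals all_analysis.
From mathcomp Require Import summability.

Set Implicit Arguments.
Unset Strict Implicit.
Unset Printing Implicit Defensive.
Import Order.TTheory GRing.Theory Num.Theory.
Import numFieldNormedType.Exports.

Local Open Scope classical_set_scope.
Local Open Scope ring_scope.

(* The norm of a normed R[i]-module takes its (nonnegative, real) values in R[i] *)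
Definition rnorm (R : realType) (V : normedModType R[i]) (x : V) : R :=
  complex.Re `|x|.

HB.mixin Record CompleteNormedModule_isCStarAlgebra (R : realType) A
    & CompleteNormedModule R[i] A := {
  cmul : A -> A -> A;
  star : A -> A;
  cmulA : associative cmul;
  cmulDl : left_distributive cmul +%R;
  cmulDr : right_distributive cmul +%R;
  cmulZl : forall (a : R[i]) (x y : A), cmul (a *: x) y = a *: cmul x y;
  cmulZr : forall (a : R[i]) (x y : A), cmul x (a *: y) = a *: cmul x y;
  starK : involutive star;
  starD : {morph star : x y / x + y};
  starZ : forall (a : R[i]) (x : A), star (a *: x) = Num.conj a *: star x;
  starM : forall x y : A, star (cmul x y) = cmul (star y) (star x);
  normr_cmul : forall x y : A, `|cmul x y| <= `|x| * `|y|;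
  normr_cstar : forall x : A, `|cmul (star x) x| = `|x| ^+ 2
}.

(* Not necessarily unital: the graph algebras of infinite graphs have no unit,
   which is why this does not extend the (unital) ring structures *)
#[short(type="cstarAlgType")]
HB.structure Definition CStarAlgebra (R : realType) :=
  {A of CompleteNormedModule R[i] A & CompleteNormedModule_isCStarAlgebra R A}.

Declare Scope cstar_scope.
Notation "x ** y" := (cmul x y) (at level 40, left associativity) : cstar_scope.
Local Open Scope cstar_scope.

HB.mixin Record CompleteNormedModule_isHilbert (R : realType) H
    & CompleteNormedModule R[i] H := {
  hdot : {dot H for @Num.conj R[i]};
  normr_hdot : forall x : H, `|x| ^+ 2 = hdot x x
}.

#[short(type="hilbertType")]
HB.structure Definition Hilbert (R : realType) :=
  {H of CompleteNormedModule R[i] H & CompleteNormedModule_isHilbert R H}.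

Section CStar.
Context {R : realType}.
Implicit Types A B : cstarAlgType R.

Definition is_star_hom A B (f : {linear A -> B}) :=
  (forall x y, f (x ** y) = f x ** f y) /\ (forall x, f (star x) = star (f x)).

Definition cstar_pos A (x : A) := exists z, x = star z ** z.
Definition cstar_le A (x y : A) := cstar_pos (y - x).

Definition is_projection A (x : A) := x ** x = x /\ star x = x.
Definition is_partial_isometry A (x : A) := x ** star x ** x = x.

(* Positivity in the C*-algebra M_n(A): x = y^* y for some y in M_n(A) *)
Definition mx_pos A n (x : 'M[A]_n) :=
  exists y : 'M[A]_n, x = \matrix_(i, j) \sum_k (star (y k i) ** y k j).

Definition completely_positive A B (f : {linear A -> B}) :=
  forall n (x : 'M[A]_n), mx_pos x -> mx_pos (map_mx f x).

Definition contractive A B (f : {linear A -> B}) :=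
  forall x, rnorm (f x) <= rnorm x.

Definition is_star_subalg A (S : set A) :=
  [/\ S 0, forall (a : R[i]) x y, S x -> S y -> S (a *: x + y),
      forall x y, S x -> S y -> S (x ** y) & forall x, S x -> S (star x)].

Definition is_abelian A (S : set A) := forall x y, S x -> S y -> x ** y = y ** x.

Definition is_basis (V : lmodType R[i]) (S : set V) d (b : 'I_d -> V) :=
  (forall i, S (b i)) /\
  forall x, S x -> exists! c : 'rV[R[i]]_d, x = \sum_i c 0 i *: b i.

Definition has_dim (V : lmodType R[i]) (S : set V) d :=
  exists b : 'I_d -> V, is_basis S b.

(* "Subalgebra" of a C*-algebra means *-subalgebra; those of a
   finite-dimensional one are automatically closed *)
Definition is_masa A (S : set A) :=
  [/\ is_star_subalg S, is_abelian S
    & forall S', is_star_subalg S' -> is_abelian S' -> S `<=` S' -> S' `<=` S].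

Definition finite_dimensional A := exists d, has_dim [set: A] d.

Definition has_rank A r := exists2 S : set A, is_masa S & has_dim S r.

End CStar.

Record cstar_subalg (R : realType) (A : cstarAlgType R) := CStarSubalg {
  csubset :> set A;
  csub_star : is_star_subalg csubset;
  csub_closed : closed csubset
}.

Definition csub_pred (R : realType) (A : cstarAlgType R) (S : cstar_subalg A) :
  {pred A} := [pred x | x \in csubset S].

Record csub_type (R : realType) (A : cstarAlgType R) (S : cstar_subalg A) :=
  CSub { csub_val :> A; csub_valP : csub_val \in csub_pred S }.

Section CSub.
Context {R : realType} {A : cstarAlgType R} (S : cstar_subalg A).
Local Notation T := (csub_type S).

Lemma csub_predE x : (x \in csub_pred S) = (x \in csubset S).
Proof. by []. Qed.

Lemma csub_submod_closed : GRing.submod_closed (csub_pred S).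
Proof.
have [S0 SD _ _] := csub_star S.
by split=> [|a x y]; rewrite !csub_predE !inE//; exact: SD.
Qed.

HB.instance Definition _ := GRing.isSubmodClosed.Build R[i] A (csub_pred S)
  (GRing.submod_closed_semi csub_submod_closed).
HB.instance Definition _ := GRing.isZmodClosed.Build A (csub_pred S)
  (GRing.submod_closedB csub_submod_closed).

HB.instance Definition _ := [isSub for @csub_val R A S].
HB.instance Definition _ := [Choice of T by <:].
HB.instance Definition _ := [SubChoice_isSubLmodule of T by <:].

Let csub_ler_normD (x y : T) : `|val (x + y)| <= `|val x| + `|val y|.
Proof. by rewrite raddfD; exact: ler_normD. Qed.
Let csub_normrZ (l : R[i]) (x : T) : `|val (l *: x)| = `|l| * `|val x|.
Proof. by rewrite linearZ normrZ. Qed.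
Let csub_normr0_eq0 (x : T) : `|val x| = 0 -> x = 0.
Proof. by move/normr0_eq0 => x0; apply/val_inj; rewrite raddf0. Qed.

HB.instance Definition _ := Lmodule_isNormed.Build R[i] T
  csub_ler_normD csub_normrZ csub_normr0_eq0.

Lemma csub_norm (x : T) : `|x| = `|val x|. Proof. by []. Qed.

Lemma csub_complete (F : set_system T) : ProperFilter F -> cauchy F -> cvg F.
Proof.
move=> FF /cauchy_ballP Fc.
have FFv : ProperFilter (val @ F) by exact: fmap_proper_filter.
have : cauchy (val @ F).
  apply/cauchy_ballP => e e0; have := Fc e e0.
  case=> -[P Q] /= [FP FQ] PQ; exists (val @` P, val @` Q) => /=.
    by split; [apply: filterS FP|apply: filterS FQ] => x ?; exists x.
  move=> _ /= [[x Px <-]] [y Qy <-]; have := PQ (x, y) (conj Px Qy).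
  by rewrite -!ball_normE /= csub_norm raddfB.
move=> /cauchy_cvg/cvg_ex[l Fl].
have Sl : l \in csub_pred S.
  rewrite csub_predE inE.
  have := @closed_cvg _ _ F FF val (csubset S) (@csub_closed _ _ S); apply=> //.
  by apply: nearW => x; have := csub_valP x; rewrite csub_predE inE.
apply/cvg_ex; exists (CSub Sl); apply/cvgrPdist_lt => e e0.
move/cvgrPdist_lt: Fl => /(_ e e0); apply: filterS => x.
by rewrite csub_norm raddfB.
Qed.

HB.instance Definition _ := Uniform_isComplete.Build T csub_complete.

Let csub_mul_subproof (x y : T) : val x ** val y \in csub_pred S.
Proof.
have [_ _ SM _] := csub_star S.
by rewrite csub_predE inE; apply: SM; apply/set_mem; exact: csub_valP.
Qed.
Let csub_star_subproof (x : T) : star (val x) \in csub_pred S.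
Proof.
have [_ _ _ Sstar] := csub_star S.
by rewrite csub_predE inE; apply: Sstar; apply/set_mem; exact: csub_valP.
Qed.

Definition csub_mul (x y : T) : T := CSub (csub_mul_subproof x y).
Definition csub_starop (x : T) : T := CSub (csub_star_subproof x).

Let csub_valD (x y : T) : csub_val (x + y) = csub_val x + csub_val y.
Proof. exact: (raddfD val). Qed.
Let csub_valZ (a : R[i]) (x : T) : csub_val (a *: x) = a *: csub_val x.
Proof. by rewrite -[LHS]/(val (a *: x)) linearZ. Qed.

Let csubE := (csub_valD, csub_valZ).
Let csub_inj : injective (@csub_val R A S). Proof. exact: val_inj. Qed.

Let csub_mulA : associative csub_mul.
Proof. by move=> x y z; apply: csub_inj; rewrite /= cmulA. Qed.
Let csub_mulDl : left_distributive csub_mul +%R.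
Proof. by move=> x y z; apply: csub_inj; rewrite csubE /= ?csubE cmulDl. Qed.
Let csub_mulDr : right_distributive csub_mul +%R.
Proof. by move=> x y z; apply: csub_inj; rewrite csubE /= ?csubE cmulDr. Qed.
Let csub_mulZl (a : R[i]) (x y : T) : csub_mul (a *: x) y = a *: csub_mul x y.
Proof. by apply: csub_inj; rewrite csubE /= ?csubE cmulZl. Qed.
Let csub_mulZr (a : R[i]) (x y : T) : csub_mul x (a *: y) = a *: csub_mul x y.
Proof. by apply: csub_inj; rewrite csubE /= ?csubE cmulZr. Qed.
Let csub_starK : involutive csub_starop.
Proof. by move=> x; apply: csub_inj; rewrite /= starK. Qed.
Let csub_starD : {morph csub_starop : x y / x + y}.
Proof. by move=> x y; apply: csub_inj; rewrite csubE /= ?csubE starD. Qed.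
Let csub_starZ (a : R[i]) (x : T) :
  csub_starop (a *: x) = Num.conj a *: csub_starop x.
Proof. by apply: csub_inj; rewrite csubE /= ?csubE starZ. Qed.
Let csub_starM (x y : T) :
  csub_starop (csub_mul x y) = csub_mul (csub_starop y) (csub_starop x).
Proof. by apply: csub_inj; rewrite /= starM. Qed.
Let csub_normM (x y : T) : `|csub_mul x y| <= `|x| * `|y|.
Proof. by rewrite !csub_norm normr_cmul. Qed.
Let csub_normC (x : T) : `|csub_mul (csub_starop x) x| = `|x| ^+ 2.
Proof. by rewrite !csub_norm normr_cstar. Qed.

HB.instance Definition _ := CompleteNormedModule_isCStarAlgebra.Build R T
  csub_mulA csub_mulDl csub_mulDr csub_mulZl csub_mulZr csub_starK csub_starD
  csub_starZ csub_starM csub_normM csub_normC.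

End CSub.

Lemma cstar_gen_subproof (R : realType) (A : cstarAlgType R) (G : set A)
    (K := [set S : set A | [/\ is_star_subalg S, closed S & G `<=` S]]) :
  is_star_subalg (\bigcap_(S in K) S) /\ closed (\bigcap_(S in K) S).
Proof.
split; last by apply: closed_bigI => S [].
split=> [S [[]]//|a x y Sx Sy S KS|x y Sx Sy S KS|x Sx S KS];
  have [[_ SD SM Ss] _ _] := KS.
- by apply: SD; [exact: Sx|exact: Sy].
- by apply: SM; [exact: Sx|exact: Sy].
- by apply: Ss; exact: Sx.
Qed.

Definition cstar_gen (R : realType) (A : cstarAlgType R) (G : set A) :
    cstar_subalg A :=
  CStarSubalg (cstar_gen_subproof G).1 (cstar_gen_subproof G).2.

(* Only meaningful when f maps S into itself, in which case the default value 0
   of insubd is never used *)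
Definition csub_restrict (R : realType) (A : cstarAlgType R)
    (S : cstar_subalg A) (f : A -> A) (x : csub_type S) : csub_type S :=
  insubd 0 (f (csub_val x)).
Arguments csub_restrict {R A} S f x.

Section Operators.
Context {R : realType} (H : hilbertType R).

Definition opnorm (T : H -> H) : \bar R :=
  ereal_sup [set (rnorm (T x))%:E | x in [set x | rnorm x <= 1]].

Record bounded_op := BoundedOp {
  op_fun :> {linear H -> H};
  op_bounded : (opnorm op_fun < +oo)%E
}.

(* Positivity of the operator on H^n with matrix T *)
Definition opmx_pos n (T : 'I_n -> 'I_n -> bounded_op) :=
  forall x : 'I_n -> H, 0 <= \sum_i \sum_j hdot (T i j (x j)) (x i).

End Operators.
Arguments opnorm {R H}.
Arguments opmx_pos {R H n}.

Section OperatorMaps.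
Context {R : realType} {A : cstarAlgType R} {H : hilbertType R}.
Implicit Types f : A -> bounded_op H.

Definition op_linear f :=
  forall (a : R[i]) x y h, f (a *: x + y) h = a *: f x h + f y h.

Definition op_completely_positive f :=
  forall n (x : 'M[A]_n), mx_pos x -> opmx_pos (fun i j => f (x i j)).

Definition op_contractive f := forall x, (opnorm (f x) <= (rnorm x)%:E)%E.

Definition is_faithful_rep f :=
  [/\ op_linear f,
      forall x y h, f (x ** y) h = f x (f y h),
      forall x h k, hdot (f (star x) h) k = hdot h (f x k)
    & forall x, (forall h, f x h = 0) -> x = 0].

End OperatorMaps.

Section Entropy.
Context {R : realType} {A : cstarAlgType R} {H : hilbertType R}.
Variable pi : A -> bounded_op H.

(* Approximation through a finite-dimensional C*-algebra B of rank r: the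
   ranks r whose infimum is rcp(w, d) *)
Definition cpa (w : set A) (d : R) (r : nat) :=
  exists (B : cstarAlgType R) (phi : {linear A -> B}) (psi : B -> bounded_op H),
    [/\ finite_dimensional B /\ has_rank B r,
        contractive phi /\ completely_positive phi,
        [/\ op_linear psi, op_contractive psi & op_completely_positive psi]
      & forall x, w x -> (opnorm (fun h => psi (phi x) h - pi x h)%R < d%:E)%E].

Definition rcp (w : set A) (d : R) : \bar R :=
  ereal_inf [set r%:R%:E | r in cpa w d].

Definition orbit_upto (F : A -> A) (w : set A) n : set A :=
  \bigcup_(i in `I_n) (iter i F @` w).

Definition ht_at (F : A -> A) (w : set A) (d : R) : \bar R :=
  limn_esup (fun n => ((n%:R^-1)%:E * lne (rcp (orbit_upto F w n) d))%E).

Definition ht (F : A -> A) : \bar R :=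
  ereal_sup [set ereal_sup [set ht_at F w d | d in [set d | 0 < d]]
            | w in [set w | finite_set w]].

End Entropy.

Record digraph := Digraph {
  vertex : choiceType;
  edge : choiceType;
  src : edge -> vertex;
  tgt : edge -> vertex
}.
Arguments src {d}.
Arguments tgt {d}.

Definition rev_graph (E : digraph) : digraph :=
  @Digraph (vertex E) (edge E) tgt src.

Section Graph.
Variable E : digraph.

Fixpoint is_path (v : vertex E) (a : seq (edge E)) : bool :=
  if a is e :: a' then (src e == v) && is_path (tgt e) a' else true.

(* The vertex v, as a path of length 0, is (v, [::]); in a path of positive
   length the first component is determined by the second *)
Record gpath := GPath {
  psrc : vertex E;
  pedges : seq (edge E);
  gpathP : is_path psrc pedges
}.

Definition plen (a : gpath) := size (pedges a).
Definition ptgt (a : gpath) := last (psrc a) (map tgt (pedges a)).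

Definition irreducible :=
  forall v w, exists a : gpath, psrc a = v /\ ptgt a = w.

Definition out_edges (v : vertex E) := [set e : edge E | src e = v].
Definition in_edges (v : vertex E) := [set e : edge E | tgt e = v].

Definition locally_finite :=
  forall v, finite_set (out_edges v) /\ finite_set (in_edges v).

Definition infinite_graph :=
  ~ (finite_set [set: vertex E] /\ finite_set [set: edge E]).

Definition paths_from (v : vertex E) n :=
  [set a : seq (edge E) | is_path v a /\ size a = n].

(* The block entropy computed at v; when E is irreducible it does not depend
   on v *)
Definition block_entropy (R : realType) (v : vertex E) : \bar R :=
  limn_esup (fun n => ((n%:R^-1)%:E * lne (counting (paths_from v n)))%E).

End Graph.
Arguments block_entropy E {R} v.

Section GraphAlgebra.
Context {R : realType} {E : digraph} {A : cstarAlgType R}.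
Variables (p : vertex E -> A) (s : edge E -> A).

Definition cuntz_krieger :=
  [/\ (forall v, is_projection (p v)) /\
        (forall v w, v <> w -> p v ** p w = 0),
      forall e, is_partial_isometry (s e),
      forall e, star (s e) ** s e = p (tgt e),
      forall e, cstar_le (s e ** star (s e)) (p (src e))
    & forall v, finite_set (out_edges v) -> out_edges v !=set0 ->
        p v = \sum_(e \in out_edges v) s e ** star (s e)].

Definition path_elt (a : gpath E) : A :=
  if pedges a is e :: es then foldl (fun x f => x ** s f) (s e) es
  else p (psrc a).

Definition gauge_core : cstar_subalg A :=
  cstar_gen [set x | exists a b : gpath E,
    plen a = plen b /\ x = path_elt a ** star (path_elt b)].

(* The sum over all edges is the limit of the net of its finite partial sums *)
Definition PhiE (x : A) : A :=
  summability.sum (fun e => s e ** x ** star (s e)).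

End GraphAlgebra.
Arguments cuntz_krieger {R E} A.

Definition is_graph_cstar_algebra (R : realType) (E : digraph)
    (A : cstarAlgType R) (p : vertex E -> A) (s : edge E -> A) :=
  [/\ cuntz_krieger A p s,
      csubset (cstar_gen (range p `|` range s)) = setT
    & forall (B : cstarAlgType R) (q : vertex E -> B) (t : edge E -> B),
        cuntz_krieger B q t ->
        exists f : {linear A -> B},
          [/\ is_star_hom f, forall v, f (p v) = q v & forall e, f (s e) = t e]].

(* Main.v *)
(** By local finiteness and the absence of sinks, the core is the closed span of
   the elements t c (t d)^*, where c and d are paths of the same length and
   Phi_E prepends an edge to both. Up to a small error, the first n iterates of
   a finite set thus lie in the span of the matrix units indexed by the paths
   of length n + m which are in a fixed finite set of vertices after some i < n
   steps; the number of these paths is at most the sum over i of products of a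
   number of paths of length i in the reversed graph and a number of paths of
   length n - i + m in the graph, which accounts for the two entropies. The
   span of the matrix units is a finite-dimensional algebra B whose rank is at
   most the number of units, and compressing x to the matrix
   (<pi(x) xi_j, xi_i>)_ij, for suitable orthonormal vectors xi_i, is a
   completely positive contraction onto B which fixes B. *)
Require Import Defs.
From HB Require Import structures.
From mathcomp Require Import all_boot all_order all_algebra finmap.
From mathcomp Require Import complex.
From mathcomp Require Import all_classical all_reals all_analysis.
From mathcomp Require Import summability.
From mathcomp Require Import ring lra.

Set Implicit Arguments.
Unset Strict Implicit.
Unset Printing Implicit Defensive.
Import Order.TTheory GRing.Theory Num.Theory.
Import numFieldNormedType.Exports.

Local Open Scope classical_set_scope.
Local Open Scope ring_scope.
Local Open Scope cstar_scope.

(** The C*-identity is the source of every norm estimate. A faithful representation is contractive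
    because a square root of [1 - a] in the unitization is produced as a fixed point. Compressions
    and finite sums over edges are first bounded up to a constant, for the powers of exponent
    [2 ^ k] of a self-adjoint element, where the norm is multiplicative; the constant disappears as
    [k] grows. The Cuntz-Krieger relations give [p v] as a sum of range projections; their
    orthogonality is derived through the representation, which acts on the core alone. Zero units
    support no vector [xi], so their indices are removed beforehand. The maximum of the two
    entropies appears because one real [c] above both bounds a product of path numbers of lengths
    [i] and [n - i + m] by a multiple of [expR (c * (n + m))], whatever [i] is; summing over [i]
    costs a factor [n], invisible to the growth rate. *)

Lemma ltr0c (R : realType) (a : R) : (0 < a%:C%C) = (0 < a).
Proof. exact: ltcR. Qed.

(** * Real-valued norms and arithmetic in C*-algebras *)

Section RealNorm.
Context {R : realType} {V : normedModType R[i]}.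
Implicit Types x y : V.

Lemma normr_rnorm x : `|x| = (rnorm x)%:C%C.
Proof. by rewrite /rnorm RRe_real// normr_real. Qed.

Lemma rnorm_ge0 x : 0 <= rnorm x.
Proof. by rewrite -ler0c -normr_rnorm. Qed.

Lemma rnorm0 : rnorm (0 : V) = 0.
Proof. by rewrite /rnorm normr0. Qed.

Lemma rnorm_eq0 x : rnorm x = 0 -> x = 0.
Proof. by move=> x0; apply: normr0_eq0; rewrite normr_rnorm x0. Qed.

Lemma rnormN x : rnorm (- x) = rnorm x.
Proof. by rewrite /rnorm normrN. Qed.

Lemma rnorm_distC x y : rnorm (x - y) = rnorm (y - x).
Proof. by rewrite /rnorm distrC. Qed.

Lemma ler_rnormD x y : rnorm (x + y) <= rnorm x + rnorm y.
Proof. by rewrite -lecR rmorphD/= -!normr_rnorm ler_normD. Qed.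

Lemma ler_rnormB x y : rnorm (x - y) <= rnorm x + rnorm y.
Proof. by rewrite -(rnormN y) ler_rnormD. Qed.

Lemma rnormZ (a : R[i]) x : rnorm (a *: x) = complex.Re `|a| * rnorm x.
Proof.
by apply: complexI; rewrite rmorphM/= -normr_rnorm normrZ RRe_real ?normr_real// normr_rnorm.
Qed.

Lemma ler_rnorm_sum (I : Type) (r : seq I) (P : pred I) (F : I -> V) :
  rnorm (\sum_(i <- r | P i) F i) <= \sum_(i <- r | P i) rnorm (F i).
Proof.
elim/big_rec2: _ => [|i y x _ yx]; first by rewrite rnorm0.
by rewrite (le_trans (ler_rnormD _ _))// lerD2l.
Qed.

Lemma normr_ltE x (e : R) : (`|x| < e%:C%C) = (rnorm x < e).
Proof. by rewrite normr_rnorm ltcR. Qed.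

End RealNorm.

Section CStarArith.
Context {R : realType} {A : cstarAlgType R}.
Implicit Types x y z : A.

Lemma cmul0x x : 0 ** x = 0.
Proof. by apply: (addrI (0 ** x)); rewrite -cmulDl !addr0. Qed.

Lemma cmulx0 x : x ** 0 = 0.
Proof. by apply: (addrI (x ** 0)); rewrite -cmulDr !addr0. Qed.

Lemma cmulNx x y : (- x) ** y = - (x ** y).
Proof. by rewrite -scaleN1r cmulZl scaleN1r. Qed.

Lemma cmulxN x y : x ** (- y) = - (x ** y).
Proof. by rewrite -scaleN1r cmulZr scaleN1r. Qed.

Lemma cmulBl x y z : (x - y) ** z = x ** z - y ** z.
Proof. by rewrite cmulDl cmulNx. Qed.

Lemma cmulBr x y z : x ** (y - z) = x ** y - x ** z.
Proof. by rewrite cmulDr cmulxN. Qed.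

Lemma cmul_suml (I : Type) (r : seq I) (P : pred I) (F : I -> A) y :
  (\sum_(i <- r | P i) F i) ** y = \sum_(i <- r | P i) F i ** y.
Proof. by apply: (big_morph (fun x => x ** y)) => [u v|]; rewrite ?cmulDl ?cmul0x. Qed.

Lemma cmul_sumr (I : Type) (r : seq I) (P : pred I) (F : I -> A) y :
  y ** (\sum_(i <- r | P i) F i) = \sum_(i <- r | P i) y ** F i.
Proof. by apply: (big_morph (fun x => y ** x)) => [u v|]; rewrite ?cmulDr ?cmulx0. Qed.

Lemma star0 : star (0 : A) = 0.
Proof. by apply: (addrI (star 0)); rewrite -starD !addr0. Qed.

Lemma starN x : star (- x) = - star x.
Proof. by rewrite -scaleN1r starZ rmorphN1 scaleN1r. Qed.

Lemma starB x y : star (x - y) = star x - star y.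
Proof. by rewrite starD starN. Qed.

Lemma star_sum (I : Type) (r : seq I) (P : pred I) (F : I -> A) :
  star (\sum_(i <- r | P i) F i) = \sum_(i <- r | P i) star (F i).
Proof. by apply: (big_morph star) => [u v|]; rewrite ?starD ?star0. Qed.

Lemma rnorm_cmul x y : rnorm (x ** y) <= rnorm x * rnorm y.
Proof. by rewrite -lecR rmorphM/= -!normr_rnorm normr_cmul. Qed.

Lemma rnorm_cstar x : rnorm (star x ** x) = rnorm x ^+ 2.
Proof. by apply: complexI; rewrite rmorphXn/= -!normr_rnorm normr_cstar. Qed.

Lemma rnorm_star x : rnorm (star x) = rnorm x.
Proof.
have le_star y : rnorm y <= rnorm (star y).
  have [->|y0] := eqVneq (rnorm y) 0; first exact: rnorm_ge0.
  by rewrite -(@ler_pM2r _ (rnorm y)) ?lt_def ?y0 ?rnorm_ge0// -expr2 -rnorm_cstar rnorm_cmul.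
by apply/eqP; rewrite eq_le le_star -{2}(starK x) le_star.
Qed.

(* Repeated squaring, x ^ (2 ^ k): there is no unit, hence no power x ^ 0 *)
Fixpoint csq k x : A := if k is k'.+1 then csq k' x ** csq k' x else x.

Lemma star_csq k x : star x = x -> star (csq k x) = csq k x.
Proof. by move=> xs; elim: k => //= k IH; rewrite starM IH. Qed.

Lemma rnorm_csq k x : star x = x -> rnorm (csq k x) = rnorm x ^+ (2 ^ k).
Proof.
move=> xs; elim: k => [|k IH]; first by rewrite expr1.
by rewrite /= -{1}(star_csq k xs) rnorm_cstar IH -exprM expnSr.
Qed.

End CStarArith.

(** If [b < a], Bernoulli's inequality makes [(a / b) ^+ n] exceed any [C], and [n < 2 ^ n] brings
    the exponent to a power of two. Such exponents are the ones for which [rnorm_csq] computes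
    norms. *)
Lemma ler_pow2_limit (R : realType) (a b C : R) : 0 <= a -> 0 <= b ->
  (forall k, a ^+ (2 ^ k) <= C * b ^+ (2 ^ k)) -> a <= b.
Proof.
move=> a0 b0 abC; rewrite leNgt; apply/negP => ba.
have agt0 : 0 < a by exact: le_lt_trans ba.
move: b0; rewrite le_eqVlt => /predU1P[b0|b0].
  by have := abC 0%N; rewrite !expr1 -b0 mulr0 leNgt agt0.
have q1 : 0 < a / b - 1 by rewrite subr_gt0 ltr_pdivlMr// mul1r.
have bern n : n%:R * (a / b - 1) <= (a / b) ^+ n.
  elim: n => [|n IH]; first by rewrite mul0r expr0.
  have le1 : 1 <= a / b by rewrite -subr_ge0 ltW.
  rewrite -natr1 exprS -[X in _ <= X * _](subrK 1).
  move: (a / b - 1) q1 IH => q q1 IH.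
  by rewrite !mulrDl !mul1r addrC lerD// ler_peMr ?(ltW q1)// exprn_ege1//.
have [n Cn] : exists n, C < n%:R * (a / b - 1).
  exists (Num.truncn (C / (a / b - 1))).+1; rewrite -ltr_pdivrMr//.
  exact: truncnS_gt.
have := abC n; rewrite leNgt => /negP; apply.
rewrite -ltr_pdivlMr ?exprn_gt0// -expr_div_n (lt_le_trans Cn)//.
rewrite (le_trans _ (bern _))// ler_wpM2r ?(ltW q1)// ler_nat ltnW//.
exact: ltn_expl.
Qed.

(** * Limits in the real-valued norm, and a fixed point theorem *)

Section RealNormLimits.
Context {R : realType} {V : normedModType R[i]}.

Lemma cvg_rnormP (T : Type) (F : set_system T) {FF : Filter F} (u : T -> V) (l : V) :
  u @ F --> l <-> forall e : R, 0 < e -> \forall t \near F, rnorm (l - u t) < e.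
Proof.
split=> [/cvgrPdist_lt ul e e0|ul].
  have := ul e%:C%C; rewrite ltr0c => /(_ e0); apply: filterS => t.
  by rewrite normr_ltE.
apply/cvgrPdist_lt => e e0; have eE : e = (complex.Re e)%:C%C.
  by rewrite RRe_real// gtr0_real.
have := ul (complex.Re e); rewrite -ltr0c -eE => /(_ e0); apply: filterS => t.
by rewrite eE normr_ltE.
Qed.

Lemma rnorm_closureP (S : set V) (x : V) :
  closure S x <-> forall e : R, 0 < e -> exists2 y, S y & rnorm (x - y) < e.
Proof.
split=> [Sx e e0|Sx].
  have /Sx[y [Sy xy]] : nbhs x (ball x e%:C%C) by apply: nbhsx_ballx; rewrite ltr0c.
  by exists y => //; move: xy; rewrite -ball_normE /= normr_ltE.
move=> B /nbhs_ballP[e /= e0 eB]; have eE : e = (complex.Re e)%:C%C.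
  by rewrite RRe_real// gtr0_real.
have [|y Sy xy] := Sx (complex.Re e); first by rewrite -ltr0c -eE.
by exists y; split=> //; apply: eB; rewrite -ball_normE /= eE normr_ltE.
Qed.

End RealNormLimits.

Lemma rnorm_cauchy_cvg (R : realType) (V : completeNormedModType R[i])
    (T : Type) (F : set_system T) {FF : ProperFilter F} (u : T -> V) :
  (forall e : R, 0 < e -> exists x : V, \forall t \near F, rnorm (x - u t) < e) ->
  cvg (u @ F).
Proof.
move=> Fu; apply: cauchy_cvg; apply: cauchy_exP => e e0.
have eE : e = (complex.Re e)%:C%C by rewrite RRe_real// gtr0_real.
have [|x ux] := Fu (complex.Re e); first by rewrite -ltr0c -eE.
exists x; near_simpl; apply: filterS ux => t.
by rewrite eE -ball_normE/= normr_ltE.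
Qed.

(** Banach's iteration started at [0]. It is kept inside a ball because the quadratic map of
    [rep_le1] contracts only there. *)
Lemma rnorm_fixed_point (R : realType) (V : completeNormedModType R[i])
    (f : V -> V) (r q : R) : 0 <= r -> 0 <= q < 1 ->
  (forall x, rnorm x <= r -> rnorm (f x) <= r) ->
  (forall x y, rnorm x <= r -> rnorm y <= r -> rnorm (f x - f y) <= q * rnorm (x - y)) ->
  exists2 x, rnorm x <= r & f x = x.
Proof.
move=> r0 /andP[q0 q1] fr fq; pose u n := iter n f 0.
have ur n : rnorm (u n) <= r by elim: n => [|n IH]; rewrite ?rnorm0//; exact: fr.
have u1 n : rnorm (u n.+1 - u n) <= q ^+ n * r.
  elim: n => [|n IH]; first by rewrite subr0 mul1r; exact: (ur 1%N).
  by apply: (le_trans (fq _ _ (ur n.+1) (ur n))); rewrite exprS -mulrA ler_wpM2l.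
have um n m : rnorm (u n - u (n + m)%N) <= q ^+ n * r / (1 - q).
  (* The sharper bound is the partial geometric sum, multiplied by [1 - q] so that the induction
     stays polynomial. *)
  suff : rnorm (u n - u (n + m)%N) * (1 - q) <= q ^+ n * r * (1 - q ^+ m).
    move=> h; rewrite ler_pdivlMr ?subr_gt0// (le_trans h)// ler_piMr ?mulr_ge0 ?exprn_ge0//.
    by rewrite gerBl exprn_ge0.
  elim: m => [|m IH]; first by rewrite addn0 !subrr rnorm0 mul0r mulr0.
  have : rnorm (u n - u (n + m.+1)%N) <= rnorm (u n - u (n + m)%N) + q ^+ (n + m) * r.
    by rewrite -(subrKA (u (n + m)%N)) (le_trans (ler_rnormD _ _))// lerD2l rnorm_distC addnS u1.
  rewrite -(@ler_pM2r _ (1 - q)) ?subr_gt0// => h; apply: (le_trans h).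
  by rewrite mulrDl (le_trans (lerD IH (lexx _)))// exprD exprS; lra.
have qn e : 0 < e -> exists n, q ^+ n * r / (1 - q) < e.
  move=> e0; have : (fun n => q ^+ n * (r / (1 - q))) @ \oo --> 0 * (r / (1 - q)).
    by apply: cvgMl; apply: cvg_expr; rewrite ger0_norm.
  rewrite mul0r => /cvgrPdist_lt/(_ e e0)[n _ /(_ n (leqnn n))].
  rewrite /= sub0r normrN mulrA ger0_norm; first by exists n.
  by rewrite !mulr_ge0 ?exprn_ge0// invr_ge0 subr_ge0 ltW.
have /cvg_ex[x ux] : cvgn u.
  apply: rnorm_cauchy_cvg => e /qn[n ne]; exists (u n); exists n => // m /= nm.
  by rewrite -(subnKC nm) (le_lt_trans (um _ _)).
have {}ux e : 0 < e -> exists n, rnorm (x - u n) < e /\ rnorm (x - u n.+1) < e.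
  by move=> /((cvg_rnormP _ _).1 ux)[n _ un]; exists n; split; apply: un => /=.
have xr : rnorm x <= r.
  apply/ler_addgt0Pr => e /ux[n [xn _]].
  by rewrite -(subrK (u n) x) (le_trans (ler_rnormD _ _))// addrC lerD// ltW.
exists x => //; apply/esym/eqP; rewrite -subr_eq0; apply/eqP/rnorm_eq0/le_anti.
rewrite rnorm_ge0 andbT; apply/ler_addgt0Pr => e e0; rewrite add0r.
have /ux[n [xn xn1]] : 0 < e / 2 by rewrite divr_gt0.
rewrite (splitr e) -(subrKA (u n.+1)) (le_trans (ler_rnormD _ _))// lerD// ?(ltW xn1)//.
apply: (le_trans (fq _ _ (ur n) xr)); rewrite (le_trans _ (ltW xn))// rnorm_distC.
by rewrite ler_piMl ?rnorm_ge0// ltW.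
Qed.

(** * Hilbert spaces and contractivity of faithful representations *)

Section Dot.
Context {R : realType} {H : hilbertType R}.
Implicit Types (x y z : H) (a : R[i]).

Lemma dotC x y : hdot x y = Num.conj (hdot y x).
Proof. by rewrite hermC expr0 mul1r. Qed.

Lemma dotDl x y z : hdot (x + y) z = hdot x z + hdot y z.
Proof. exact: linearDl. Qed.
Lemma dotBl x y z : hdot (x - y) z = hdot x z - hdot y z.
Proof. exact: linearBl. Qed.
Lemma dotBr x y z : hdot z (x - y) = hdot z x - hdot z y.
Proof. exact: linearBr. Qed.
Lemma dot0l x : hdot 0 x = 0. Proof. exact: linear0l. Qed.
Lemma dot0r x : hdot x 0 = 0. Proof. exact: linear0r. Qed.
Lemma dotZl a x y : hdot (a *: x) y = a * hdot x y.
Proof. exact: linearZl_LR. Qed.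
Lemma dotZr a x y : hdot x (a *: y) = Num.conj a * hdot x y.
Proof. exact: linearZr_LR. Qed.

Lemma dot_suml I (r : seq I) (P : pred I) (F : I -> H) x :
  hdot (\sum_(i <- r | P i) F i) x = \sum_(i <- r | P i) hdot (F i) x.
Proof. exact: linear_sumlz. Qed.
Lemma dot_sumr I (r : seq I) (P : pred I) (F : I -> H) x :
  hdot x (\sum_(i <- r | P i) F i) = \sum_(i <- r | P i) hdot x (F i).
Proof. exact: linear_sumr. Qed.

Lemma dotxx x : hdot x x = (rnorm x ^+ 2)%:C%C.
Proof. by rewrite -normr_hdot normr_rnorm rmorphXn. Qed.

Lemma dotxx_ge0 x : 0 <= hdot x x.
Proof. by rewrite -normr_hdot exprn_ge0. Qed.

Lemma dotxx_eq0 x : hdot x x = 0 -> x = 0.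
Proof. by move=> /eqP; rewrite -normr_hdot sqrf_eq0 normr_eq0 => /eqP. Qed.

Lemma cauchy_schwarz x y : `|hdot x y| <= `|x| * `|y|.
Proof.
have [->|y0] := eqVneq y 0; first by rewrite dot0r normr0 normr0 mulr0.
have q0 : 0 < `|y| ^+ 2 by rewrite exprn_gt0// normr_gt0.
rewrite -(@ler_pXn2r _ 2)// ?nnegrE ?mulr_ge0// exprMn -ler_pdivrMr//.
have := dotxx_ge0 (x - (hdot x y / `|y| ^+ 2) *: y).
rewrite dotBl !dotBr !dotZl !dotZr -!normr_hdot (dotC y x) rmorphM/= fmorphV/=.
rewrite (conj_Creal (ger0_real (ltW q0))) normCK => h; rewrite -subr_ge0; apply: (le_trans h).
rewrite le_eqVlt; apply/orP; left; apply/eqP; move: (hdot x y) (Num.conj (hdot x y)) (`|x| ^+ 2) (`|y| ^+ 2) q0.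
by move=> d d' p q /lt0r_neq0 q0; field.
Qed.

End Dot.

Section Representation.
Context {R : realType} {A : cstarAlgType R} {H : hilbertType R}.
Variable pi : A -> bounded_op H.
Hypothesis pi_faithful : is_faithful_rep pi.

Lemma repP a x y h : pi (a *: x + y) h = a *: pi x h + pi y h.
Proof. by case: pi_faithful => + _ _ _; exact. Qed.
Lemma repM x y h : pi (x ** y) h = pi x (pi y h).
Proof. by case: pi_faithful => _ + _ _; exact. Qed.
Lemma rep_star x h k : hdot (pi (star x) h) k = hdot h (pi x k).
Proof. by case: pi_faithful => _ _ + _; exact. Qed.
Lemma rep_eq0 x : (forall h, pi x h = 0) -> x = 0.
Proof. by case: pi_faithful => _ _ _; exact. Qed.

Lemma repD x y h : pi (x + y) h = pi x h + pi y h.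
Proof. by rewrite -[x]scale1r repP !scale1r. Qed.
Lemma rep0 h : pi 0 h = 0.
Proof. by apply: (addrI (pi 0 h)); rewrite -repD !addr0. Qed.
Lemma repZ a x h : pi (a *: x) h = a *: pi x h.
Proof. by rewrite -[a *: x]addr0 repP rep0 addr0. Qed.
Lemma repB x y h : pi (x - y) h = pi x h - pi y h.
Proof. by rewrite repD -scaleN1r repZ scaleN1r. Qed.
Lemma rep_sum I (r : seq I) (P : pred I) (F : I -> A) h :
  pi (\sum_(i <- r | P i) F i) h = \sum_(i <- r | P i) pi (F i) h.
Proof. by apply: (big_morph (fun x => pi x h)) => [x y|]; rewrite ?repD ?rep0. Qed.
Lemma rep_starr x h k : hdot (pi x h) k = hdot h (pi (star x) k).
Proof. by rewrite -{1}(starK x) rep_star. Qed.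
Lemma dot_rep x h : hdot (pi (star x ** x) h) h = hdot (pi x h) (pi x h).
Proof. by rewrite repM rep_star. Qed.

(* For ||a|| < 1 the fixed point y of y |-> (a + y^2) / 2 satisfies
   1 - a = (1 - y)^2 in the unitization, whence <pi(a)h, h> <= ||h||^2. *)
Lemma rep_le1 x h : rnorm x < 1 -> rnorm (pi x h) <= rnorm h.
Proof.
move=> x1; pose a := star x ** x; have sa : star a = a by rewrite starM starK.
have ra : rnorm a = rnorm x ^+ 2 by rewrite rnorm_cstar.
have ra0 : 0 <= rnorm a by exact: rnorm_ge0.
have ra1 : rnorm a < 1 by rewrite ra expr_lt1// rnorm_ge0.
pose f (y : A) : A := (2^-1 : R[i]) *: (a + y ** y).
have n2 : complex.Re `|2^-1 : R[i]| = 2^-1.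
  by rewrite ger0_norm ?invr_ge0// -(@rmorph_nat R _ (real_complex R)) -fmorphV.
have fr y : rnorm y <= rnorm a -> rnorm (f y) <= rnorm a.
  move=> ya; rewrite rnormZ n2 ler_pdivrMl//.
  rewrite (le_trans (ler_rnormD _ _))// mulr_natl mulr2n lerD2l.
  rewrite (le_trans (rnorm_cmul _ _))// -[leRHS]mul1r ler_pM ?rnorm_ge0//.
  exact: le_trans (ltW ra1).
have fq y z : rnorm y <= rnorm a -> rnorm z <= rnorm a ->
    rnorm (f y - f z) <= rnorm a * rnorm (y - z).
  move=> ya za; rewrite -scalerBr rnormZ n2 opprD addrACA subrr add0r ler_pdivrMl//.
  have -> : y ** y - z ** z = y ** (y - z) + (y - z) ** z.
    by rewrite cmulBr cmulBl subrKA.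
  rewrite (le_trans (ler_rnormD _ _))// mulr_natl mulr2n lerD//.
    by rewrite (le_trans (rnorm_cmul _ _))// ler_wpM2r ?rnorm_ge0.
  by rewrite (le_trans (rnorm_cmul _ _))// mulrC ler_wpM2r ?rnorm_ge0.
have [|y ya fy] := rnorm_fixed_point ra0 _ fr fq; first by rewrite ra0.
(* The adjoint of [y] is again a fixed point in the ball, and a contraction has only one. *)
have sy : star y = y.
  apply/eqP; rewrite -subr_eq0; apply/eqP/rnorm_eq0/eqP; rewrite eq_le rnorm_ge0 andbT.
  rewrite leNgt; apply/negP => sy0.
  have fsy : f (star y) = star y.
    rewrite -{2}fy /f starZ starD starM sa; congr (_ *: _).
    by rewrite conj_Creal// realV realn.
  have := fq (star y) y; rewrite rnorm_star => /(_ ya ya).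
  by rewrite fsy fy leNgt => /negP; apply; rewrite gtr_pMl.
have aE : a = y + y - y ** y.
  rewrite -{1 2}fy -[LHS](addrK (y ** y)); congr (_ - _).
  by rewrite -scalerDl -div1r -splitr scale1r.
rewrite -(@ler_pXn2r _ 2)// ?nnegrE ?rnorm_ge0// -lecR -!dotxx -dot_rep -/a aE.
rewrite repB !repD repM dotBl -{3}sy rep_star dotDl.
(* Since [a] is [2 y - y^2] with [y] self-adjoint, the gap between [hdot h h] and [hdot (pi a h) h]
   is exactly the square of the norm of [h - pi y h]. *)
have := dotxx_ge0 (h - pi y h).
rewrite dotBl !dotBr -(rep_star y h h) sy => hy; rewrite -subr_ge0; apply: (le_trans hy).
by rewrite le_eqVlt; apply/orP; left; apply/eqP; ring.
Qed.

Lemma rep_contractive x h : rnorm (pi x h) <= rnorm x * rnorm h.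
Proof.
(* Dividing [x] by [rnorm x + d] brings its norm strictly below [1]; [d] is such that the excess
   [d * rnorm h] is at most [e], also for [h = 0]. *)
apply/ler_addgt0Pr => e e0; pose d := e / (rnorm h + 1).
have h1 : 0 < rnorm h + 1 by rewrite ltr_wpDl ?rnorm_ge0.
have d0 : 0 < d by rewrite divr_gt0.
pose c := rnorm x + d; have c0 : 0 < c by rewrite ltr_wpDl ?rnorm_ge0.
have cn : complex.Re `|c^-1%:C%C| = c^-1 by rewrite ger0_norm ?lecR ?ler0c ?invr_ge0 ?ltW.
have := @rep_le1 (c^-1%:C%C *: x) h; rewrite repZ !rnormZ cn !ler_pdivrMl// ltr_pdivrMl// mulr1.
rewrite ltrDl => /(_ d0) hc; rewrite (le_trans hc)// mulrDl lerD2l /d mulrAC.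
by rewrite ler_pdivrMr// ler_wpM2l ?(ltW e0)// lerDl.
Qed.

End Representation.

Lemma rnorm_cauchy_schwarz (R : realType) (H : hilbertType R) (x y : H) :
  complex.Re `|hdot x y| <= rnorm x * rnorm y.
Proof.
by rewrite -lecR rmorphM/= -!normr_rnorm cauchy_schwarz.
Qed.

(* The units of a direct sum of matrix algebras: [e i j] is the (i, j) unit when
   i and j lie in the same block, i.e. r i = r j, and vanishes otherwise *)
Record matrix_units (R : realType) (A : cstarAlgType R) (I : finType) (J : eqType)
    (r : I -> J) (e : I -> I -> A) := MatrixUnits {
  munit_off : forall i j, r i != r j -> e i j = 0;
  munit_star : forall i j, star (e i j) = e j i;
  munit_mul : forall i j k, r i = r j -> e i j ** e j k = e i k;
  munit_mul0 : forall i j k l, j != k -> e i j ** e k l = 0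
}.

(** * Compression onto the span of a system of matrix units *)

Section MatrixUnits.
Context {R : realType} {A : cstarAlgType R} {H : hilbertType R}.
Variable pi : A -> bounded_op H.
Hypothesis pi_rep : is_faithful_rep pi.
Context {I : finType} {J : eqType} {r : I -> J} {e : I -> I -> A}.
Hypothesis e_units : matrix_units r e.

(** In each block, a unit vector in the range of one diagonal projection is carried to the other
    indices by the units of that column. The relations between the units then force orthonormality
    and the standard action. *)
Lemma munit_vectors : (forall i, e i i != 0) -> exists xi : I -> H,
  (forall i j k, pi (e i j) (xi k) = if (j == k) && (r i == r j) then xi i else 0) /\
  (forall i j, hdot (xi i) (xi j) = (i == j)%:R).
Proof.
move=> e_neq0.
have eta_ex i : exists h, hdot h h = 1 /\ pi (e i i) h = h.
  have [h h0] : exists h, pi (e i i) h <> 0.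
    apply/existsNP => h0; move/eqP: (e_neq0 i); apply.
    exact: (rep_eq0 pi_rep).
  have n0 : `|pi (e i i) h| != 0 by rewrite normr_eq0; exact/eqP.
  exists (`|pi (e i i) h|^-1 *: pi (e i i) h); split.
    rewrite dotZl dotZr -normr_hdot conj_Creal ?realV ?normr_real//.
    by rewrite expr2 mulKf// mulVf.
  by rewrite linearZ/= -(repM pi_rep) (munit_mul e_units).
have [eta eta1] := choice eta_ex.
(* The representative of the block of [i]; the search succeeds, [i] itself being a candidate, and
   its outcome depends on [r i] only. *)
pose rp i := if [pick k | r k == r i] is Some k then k else i.
have rpE i : r (rp i) = r i by rewrite /rp; case: pickP => // k /eqP.
have rp_eq i j : r i = r j -> rp i = rp j.
  move=> ij; rewrite /rp.
  have /eq_pick -> : (fun k => r k == r i) =1 (fun k => r k == r j) by move=> k; rewrite ij.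
  by case: pickP => // /(_ j); rewrite eqxx.
exists (fun i => pi (e i (rp i)) (eta (rp i))); split=> [i j k|i j].
  rewrite -(repM pi_rep); case: eqVneq => [->|jk]/=; last by rewrite (munit_mul0 e_units)// (rep0 pi_rep).
  case: eqVneq => [ik|ik]; last by rewrite (munit_off e_units ik) cmul0x (rep0 pi_rep).
  by rewrite (munit_mul e_units)// (rp_eq i k).
rewrite (rep_starr pi_rep) -(repM pi_rep) (munit_star e_units).
case: eqVneq => [->|ij]; last by rewrite (munit_mul0 e_units)// (rep0 pi_rep) dot0r.
rewrite (munit_mul e_units)//; have [h1 ->] := eta1 (rp j); exact: h1.
Qed.

Variable xi : I -> H.
Hypothesis xi_e : forall i j k,
  pi (e i j) (xi k) = if (j == k) && (r i == r j) then xi i else 0.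
Hypothesis xi_dot : forall i j, hdot (xi i) (xi j) = (i == j)%:R.

Definition mcoef x i j := hdot (pi x (xi j)) (xi i).

(** Coefficients between different blocks may be nonzero, but they multiply a zero unit: the
    compression is block diagonal. *)
Definition mexp x := \sum_i \sum_j mcoef x i j *: e i j.

Lemma mcoefP a x y i j : mcoef (a *: x + y) i j = a * mcoef x i j + mcoef y i j.
Proof. by rewrite /mcoef (repP pi_rep) dotDl dotZl. Qed.

Lemma mcoef_unit i j k l :
  mcoef (e k l) i j = [&& i == k, j == l & r k == r l]%:R.
Proof.
rewrite /mcoef xi_e (eq_sym j).
case: eqVneq => _; last by rewrite dot0l andbF.
by case: eqVneq => _; rewrite ?dot0l ?andbF// xi_dot eq_sym !andbT.
Qed.

Lemma mcoef_star x i j : mcoef (star x) i j = Num.conj (mcoef x j i).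
Proof. by rewrite /mcoef (rep_star pi_rep) dotC. Qed.

Lemma mexp_is_linear : linear mexp.
Proof.
move=> a x y; rewrite /mexp scaler_sumr -big_split; apply: eq_bigr => i _ /=.
rewrite scaler_sumr -big_split; apply: eq_bigr => j _ /=.
by rewrite mcoefP scalerDl scalerA.
Qed.

HB.instance Definition _ := GRing.isLinear.Build R[i] A A _ mexp mexp_is_linear.

Lemma mexp_unit k l : mexp (e k l) = e k l.
Proof.
rewrite /mexp (bigD1 k)//= [X in _ + X]big1 ?addr0; last first.
  by move=> i ik; rewrite big1// => j _; rewrite mcoef_unit (negbTE ik) scale0r.
rewrite (bigD1 l)//= big1 ?addr0; last first.
  by move=> j jl; rewrite mcoef_unit (negbTE jl) andbF scale0r.
rewrite mcoef_unit !eqxx/=; case: eqVneq => kl; first by rewrite scale1r.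
by rewrite (munit_off e_units kl) scaler0.
Qed.

Lemma mexp_idem x : mexp (mexp x) = mexp x.
Proof.
rewrite [X in mexp X]/mexp [RHS]/mexp linear_sum; apply: eq_bigr => i _.
rewrite linear_sum; apply: eq_bigr => j _.
by rewrite linearZ/= mexp_unit.
Qed.

Lemma mexp_star x : mexp (star x) = star (mexp x).
Proof.
rewrite /mexp star_sum exchange_big; apply: eq_bigr => i _ /=.
rewrite star_sum; apply: eq_bigr => j _ /=.
by rewrite starZ (munit_star e_units) mcoef_star.
Qed.

Lemma mexp_mul x y : mexp x = x -> mexp y = y -> mexp (x ** y) = x ** y.
Proof.
move=> xx yy; rewrite -xx -yy [X in mexp (X ** _)]/mexp [X in _ = X ** _]/mexp !cmul_suml linear_sum; apply: eq_bigr => i _.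
rewrite !cmul_suml linear_sum; apply: eq_bigr => j _.
rewrite !cmulZl linearZ/=; congr (_ *: _).
rewrite [X in mexp (_ ** X)]/mexp [X in _ = _ ** X]/mexp !cmul_sumr linear_sum; apply: eq_bigr => k _.
rewrite !cmul_sumr linear_sum; apply: eq_bigr => l _.
rewrite !cmulZr linearZ/=; congr (_ *: _).
have [->|jk] := eqVneq j k; last by rewrite (munit_mul0 e_units)// linear0.
have [ik|ik] := eqVneq (r i) (r k); first by rewrite (munit_mul e_units)// mexp_unit.
by rewrite (munit_off e_units ik) cmul0x linear0.
Qed.

Let proj j h := \sum_(i | r i == j) hdot h (xi i) *: xi i.

Let dot_proj j h i : r i == j -> hdot (proj j h) (xi i) = hdot h (xi i).
Proof.
move=> ij; rewrite /proj dot_suml (bigD1 i)//= dotZl xi_dot eqxx mulr1 big1 ?addr0//.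
by move=> k /andP[_ ki]; rewrite dotZl xi_dot (negbTE ki) mulr0.
Qed.

Let proj_idem j h : proj j (proj j h) = proj j h.
Proof. by rewrite {1}/proj; apply: eq_bigr => i ij; rewrite dot_proj. Qed.

Let rnorm_proj j h : rnorm (proj j h) <= rnorm h.
Proof.
have [->|p0] := eqVneq (rnorm (proj j h)) 0; first exact: rnorm_ge0.
have pgt0 : 0 < rnorm (proj j h) by rewrite lt_def p0 rnorm_ge0.
rewrite -(@ler_pM2r _ (rnorm (proj j h)))// -expr2.
have pp : hdot (proj j h) (proj j h) = hdot h (proj j h).
  by rewrite {2 3}/proj !dot_sumr; apply: eq_bigr => i ij; rewrite !dotZr dot_proj.
rewrite (le_trans _ (rnorm_cauchy_schwarz _ _))// -pp dotxx.
by rewrite ger0_norm ?lecR ?exprn_ge0 ?rnorm_ge0.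
Qed.

Let rep_mexp_xi x k : pi (mexp x) (xi k) = \sum_(i | r i == r k) mcoef x i k *: xi i.
Proof.
rewrite (rep_sum pi_rep) [RHS]big_mkcond; apply: eq_bigr => i _.
rewrite (rep_sum pi_rep) (bigD1 k)//= (repZ pi_rep) xi_e eqxx/=.
rewrite big1 ?addr0; first by case: ifP; rewrite ?scaler0.
by move=> l lk; rewrite (repZ pi_rep) xi_e (negbTE lk) scaler0.
Qed.

(** On the vectors of one block, the compressed element acts as [pi x] followed by an orthogonal
    projection, hence with norm at most [rnorm x]. *)
Let rep_mexp j x w : proj j w = w -> pi (mexp x) w = proj j (pi x w).
Proof.
move=> ww; rewrite -{1}ww {1}/proj linear_sum/= /proj.
under eq_bigr => k kj do rewrite linearZ/= rep_mexp_xi (eqP kj) scaler_sumr.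
rewrite exchange_big/=; apply: eq_bigr => i ij.
have -> : pi x w = \sum_(k | r k == j) hdot w (xi k) *: pi x (xi k).
  by rewrite -{1}ww /proj linear_sum; apply: eq_bigr => k _; rewrite linearZ.
rewrite dot_suml scaler_suml; apply: eq_bigr => k kj.
by rewrite dotZl scalerA.
Qed.

(** The operator norm of a block matrix, taken block by block. Unlike the norm of the algebra it is
    visibly decreased by compression, and it is submultiplicative. *)
Let mbounded (M : R) x := mexp x = x /\
  forall j w, proj j w = w -> rnorm (pi x w) <= M * rnorm w.

Let mboundedM M N x y : 0 <= M -> mbounded M x -> mbounded N y -> mbounded (M * N) (x ** y).
Proof.
move=> M0 [xx Mx] [yy Ny]; split=> [|j w ww]; first exact: mexp_mul.
rewrite (repM pi_rep) -mulrA; apply: (@le_trans _ _ (M * rnorm (pi y w))).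
  by apply: (Mx j); rewrite -yy (rep_mexp _ ww) proj_idem.
by rewrite ler_wpM2l// (Ny j).
Qed.

Let mbounded_csq M x k : 0 <= M -> mbounded M x -> mbounded (M ^+ (2 ^ k)) (csq k x).
Proof.
move=> M0 Mx; elim: k => [|k IH]; first by rewrite expr1.
by rewrite expnSr exprM expr2; apply: mboundedM => //; rewrite exprn_ge0.
Qed.

Let mbounded_mexp x : mbounded (rnorm x) (mexp x).
Proof.
split=> [|j w ww]; first exact: mexp_idem.
by rewrite (rep_mexp _ ww) (le_trans (rnorm_proj _ _))// (rep_contractive pi_rep).
Qed.

(** By Cauchy-Schwarz every coefficient is at most [M]. The triangle inequality then costs a
    constant, but one that is independent of [x] and so survives the passage to powers. *)
Let mbounded_rnorm M x : mbounded M x -> rnorm x <= (\sum_i \sum_j rnorm (e i j)) * M.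
Proof.
move=> [xx Mx]; rewrite -{1}xx (le_trans (ler_rnorm_sum _ _ _))// mulr_suml ler_sum// => i _.
rewrite (le_trans (ler_rnorm_sum _ _ _))// mulr_suml ler_sum// => j _.
have xi1 k : rnorm (xi k) = 1.
  by apply/eqP; rewrite -(@eqrXn2 _ 2)// ?rnorm_ge0// -(inj_eq (@complexI _)) -dotxx xi_dot eqxx expr1n.
rewrite rnormZ mulrC ler_wpM2l ?rnorm_ge0// (le_trans (rnorm_cauchy_schwarz _ _))//.
rewrite xi1 mulr1 -[leRHS]mulr1 -(xi1 j) (Mx (r j))// /proj (bigD1 j)//= xi_dot eqxx scale1r.
by rewrite big1 ?addr0// => k /andP[_ kj]; rewrite xi_dot eq_sym (negbTE kj) scale0r.
Qed.

(* The norm of a matrix is recovered from its action on the span of the xi's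
   because all norms on the matrices are equivalent, and the constant
   disappears when the norms of the powers (b^* b)^(2^k) are compared. *)
Lemma mexp_contractive x : rnorm (mexp x) <= rnorm x.
Proof.
rewrite -(@ler_pXn2r _ 2)// ?nnegrE ?rnorm_ge0// -rnorm_cstar.
have sb : star (star (mexp x) ** mexp x) = star (mexp x) ** mexp x by rewrite starM starK.
apply: (ler_pow2_limit (C := \sum_i \sum_j rnorm (e i j))) => [||k].
- exact: rnorm_ge0.
- by rewrite exprn_ge0// rnorm_ge0.
rewrite -rnorm_csq//; apply: mbounded_rnorm; apply: mbounded_csq; rewrite ?exprn_ge0 ?rnorm_ge0//.
rewrite expr2; apply: mboundedM; [exact: rnorm_ge0| |exact: mbounded_mexp].
by rewrite -mexp_star -(rnorm_star x); exact: mbounded_mexp.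
Qed.

End MatrixUnits.
Arguments mexp {R A H} pi {I} e xi x.

(** * Linear spans, dual bases, Gram matrices *)

Inductive lspan (K : nzRingType) (V : lmodType K) (G : set V) : set V :=
| lspan0 : lspan G 0
| lspanD a x y of G x & lspan G y : lspan G (a *: x + y).

Section Lspan.
Context {K : nzRingType} {V : lmodType K}.
Implicit Types (G : set V) (x y : V).

Lemma lspan_gen G x : G x -> lspan G x.
Proof. by move=> Gx; rewrite -[x]scale1r -[X in lspan _ X]addr0; apply: lspanD => //; exact: lspan0. Qed.

Lemma lspanP G a x y : lspan G x -> lspan G y -> lspan G (a *: x + y).
Proof.
elim=> [|b u v Gu _ IH] Gy; first by rewrite scaler0 add0r.
by rewrite scalerDr -addrA scalerA; apply: lspanD => //; exact: IH.
Qed.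

Lemma lspanZ G a x : lspan G x -> lspan G (a *: x).
Proof. by move=> Gx; rewrite -[a *: x]addr0; apply: lspanP => //; exact: lspan0. Qed.

Lemma lspan_add G x y : lspan G x -> lspan G y -> lspan G (x + y).
Proof. by move=> Gx Gy; rewrite -[x]scale1r; exact: lspanP. Qed.

Lemma lspan_sum G (I : Type) (r : seq I) (P : pred I) (F : I -> V) :
  (forall i, P i -> lspan G (F i)) -> lspan G (\sum_(i <- r | P i) F i).
Proof.
by move=> GF; elim/big_rec: _ => [|i x Pi Gx]; [exact: lspan0|apply: lspan_add; [exact: GF|]].
Qed.

Lemma lspan_sub G G' x : (forall y, G y -> lspan G' y) -> lspan G x -> lspan G' x.
Proof.
by move=> GG'; elim=> [|a u v Gu _ IH]; [exact: lspan0|apply: lspanP; [exact: GG'|]].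
Qed.

End Lspan.

(** The functions [f k] read off coordinates, which gives uniqueness; in the applications they are
    matrix coefficients. *)
Lemma has_dim_dual (R : realType) (V : lmodType R[i]) (S : set V) (K : finType)
    (b : K -> V) (f : K -> V -> R[i]) :
  (forall k, S (b k)) ->
  (forall (c : K -> R[i]) k, f k (\sum_l c l *: b l) = c k) ->
  (forall x, S x -> x = \sum_k f k x *: b k) -> has_dim S #|K|.
Proof.
move=> Sb fb Sf; exists (b \o enum_val); split=> [i|x Sx]; first exact: Sb.
have sumE (c : 'rV[R[i]]_#|K|) :
    \sum_i c 0 i *: (b \o enum_val) i = \sum_k c 0 (enum_rank k) *: b k.
  rewrite (reindex (@enum_val K predT)) /=; last first.
    by exists enum_rank => i _; rewrite ?enum_valK ?enum_rankK.
  by apply: eq_bigr => i _; rewrite enum_valK.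
exists (\row_i f (enum_val i) x); split=> [|c xc].
  by rewrite sumE {1}(Sf x Sx); apply: eq_bigr => k _; rewrite mxE enum_rankK.
apply/rowP => i; rewrite mxE xc sumE.
by rewrite (fb (fun k => c 0 (enum_rank k))) enum_valK.
Qed.

(* By Gram-Schmidt; what matters is that Z is square. *)
Lemma gram_factor (R : realType) (H : hilbertType R) (K : finType) (n : nat)
    (P : {set K}) (u : K -> 'I_n -> H) :
  exists Z : K -> K -> R[i], forall a b, a \in P -> b \in P ->
    \sum_k hdot (u b k) (u a k) = \sum_(c in P) Num.conj (Z c a) * Z c b.
Proof.
move: {2}#|P| (leqnn #|P|) => m; elim: m P u => [|m IH] P u Pm.
  exists (fun _ _ => 0) => a b aP; move: Pm; rewrite leqn0 cards_eq0 => /eqP P0.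
  by rewrite P0 finset.inE in aP.
have [->|/finset.set0Pn[ o oP]] := eqVneq P finset.set0.
  by exists (fun _ _ => 0) => a b; rewrite inE.
pose D b a := \sum_k hdot (u b k) (u a k).
pose q := D o o; pose c a := D a o / q.
have q0 : 0 <= q by apply: sumr_ge0 => k _; exact: dotxx_ge0.
have DC a b : D a b = Num.conj (D b a).
  by rewrite /D rmorph_sum; apply: eq_bigr => k _; rewrite dotC.
have Do b : D b o = c b * q.
  have [qq|qq] := eqVneq q 0; last by rewrite /c mulfVK.
  rewrite qq mulr0 /D big1// => k _.
  have : hdot (u o k) (u o k) == 0.
    have /eqP := qq; rewrite psumr_eq0 => [/allP|j _]; last exact: dotxx_ge0.
    by move=> /(_ k); rewrite mem_index_enum => /(_ isT).
  by move=> /eqP/dotxx_eq0 ->; rewrite dot0r.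
have oD a : D o a = Num.conj (c a) * q.
  by rewrite DC Do rmorphM/= (conj_Creal (ger0_real q0)).
have co : c o * q = q by rewrite -Do.
pose u' a k := u a k - c a *: u o k.
have D' a b : \sum_k hdot (u' b k) (u' a k) = D b a - c b * Num.conj (c a) * q.
  transitivity (D b a - Num.conj (c a) * D b o - (c b * D o a - c b * Num.conj (c a) * q)).
    rewrite /q /D !mulr_sumr -!sumrB; apply: eq_bigr => k _.
    by rewrite /u' dotBl !dotBr !dotZl !dotZr; ring.
  by rewrite Do oD; ring.
have [|Z ZP] := IH (P :\ o) u'.
  by move: Pm; rewrite (cardsD1 o) oP.
(* A Cholesky factor: the row of [o] carries the component along [u o] that was removed, and the
   remaining rows vanish in the column of [o]. *)
exists (fun x a => if x == o then c a * sqrtC q else if a == o then 0 else Z x a).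
move=> a b aP bP; rewrite (bigD1 o)//= eqxx -/(D b a).
have -> : Num.conj (c a * sqrtC q) * (c b * sqrtC q) = c b * Num.conj (c a) * q.
  have sq0 : 0 <= sqrtC q by rewrite sqrtC_ge0.
  rewrite rmorphM/= (conj_Creal (ger0_real sq0)).
  by rewrite -[in RHS](sqrtCK q); ring.
have [ao|ao] := eqVneq a o.
  rewrite big1 ?addr0; last by move=> x /andP[_ /negbTE ->]; rewrite rmorph0 mul0r.
  by rewrite {}ao Do -mulrA -oD.
have [bo|bo] := eqVneq b o.
  rewrite big1 ?addr0; last by move=> x /andP[_ /negbTE ->]; rewrite mulr0.
  by rewrite {}bo oD mulrAC co mulrC.
rewrite -(subrK (c b * Num.conj (c a) * q) (D b a)) addrC; congr (_ + _).
rewrite -D' ZP ?finset.inE ?ao ?bo//; apply: eq_big => x; rewrite !finset.inE 1?andbC//.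
by move=> /andP[_ /negbTE ->].
Qed.

Lemma csub_val_sum (R : realType) (A : cstarAlgType R) (S : cstar_subalg A)
    (I : Type) (r : seq I) (P : pred I) (F : I -> csub_type S) :
  csub_val (\sum_(i <- r | P i) F i) = \sum_(i <- r | P i) csub_val (F i).
Proof. exact: (raddf_sum val). Qed.

Lemma csub_valZ (R : realType) (A : cstarAlgType R) (S : cstar_subalg A)
    (a : R[i]) (x : csub_type S) : csub_val (a *: x) = a *: csub_val x.
Proof. by rewrite -[LHS]/(val (a *: x)) linearZ. Qed.

Lemma csub_valD (R : realType) (A : cstarAlgType R) (S : cstar_subalg A)
    (x y : csub_type S) : csub_val (x + y) = csub_val x + csub_val y.
Proof. exact: (raddfD val). Qed.

Lemma csub_valB (R : realType) (A : cstarAlgType R) (S : cstar_subalg A)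
    (x y : csub_type S) : csub_val (x - y) = csub_val x - csub_val y.
Proof. exact: (raddfB val). Qed.

Lemma csub_val_inj (R : realType) (A : cstarAlgType R) (S : cstar_subalg A) :
  injective (@csub_val R A S).
Proof. exact: val_inj. Qed.

Lemma rnorm_csub (R : realType) (A : cstarAlgType R) (S : cstar_subalg A)
    (x : csub_type S) : rnorm x = rnorm (csub_val x).
Proof. by []. Qed.

Lemma csub_mem (R : realType) (A : cstarAlgType R) (S : cstar_subalg A)
    (x : csub_type S) : csubset S (csub_val x).
Proof. exact: set_mem (csub_valP x). Qed.

Lemma opnorm_le (R : realType) (H : hilbertType R) (T : H -> H) (M : R) :
  (forall h, rnorm h <= 1 -> rnorm (T h) <= M) -> (opnorm T <= M%:E)%E.
Proof. by move=> TM; apply: ge_ereal_sup => _ [h h1 <-]; rewrite lee_fin TM. Qed.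

(** * The finite-dimensional algebra of the units and its rank *)

Section MatrixUnitsApproximation.
Context {R : realType} {A : cstarAlgType R} {H : hilbertType R}.
Variable pi : A -> bounded_op H.
Hypothesis pi_rep : is_faithful_rep pi.
Context {I : finType} {J : eqType} {r : I -> J} {e : I -> I -> A}.
Hypothesis e_units : matrix_units r e.
Variable xi : I -> H.
Hypothesis xi_e : forall i j k,
  pi (e i j) (xi k) = if (j == k) && (r i == r j) then xi i else 0.
Hypothesis xi_dot : forall i j, hdot (xi i) (xi j) = (i == j)%:R.

Local Notation mexp := (mexp pi e xi).
Local Notation mcoef := (mcoef pi xi).

Let mexp_linear : linear mexp := mexp_is_linear pi_rep xi.
Let mexpB x y : mexp (x - y) = mexp x - mexp y.
Proof. by rewrite addrC -scaleN1r mexp_linear scaleN1r addrC. Qed.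

Lemma mexp_lspan x : lspan [set y | exists i j, y = e i j] x -> mexp x = x.
Proof.
elim=> [|a u v [i [j ->]] _ IH]; last first.
  by rewrite mexp_linear IH (mexp_unit e_units xi_e xi_dot).
by have := mexp_linear (-1) 0 0; rewrite !scaleN1r !oppr0 !add0r addNr.
Qed.

(** The span of the units, described by fixed points so that it is closed by the contractivity of
    [mexp]. *)
Let mexp_fix := [set x | mexp x = x].

Let mexp_fix_star : is_star_subalg mexp_fix.
Proof.
rewrite /mexp_fix; split=> [|a x y /= xx yy|x y|x /= xx] /=.
- by apply: mexp_lspan; exact: lspan0.
- by rewrite mexp_linear xx yy.
- exact: (mexp_mul pi_rep e_units xi_e xi_dot).
- by rewrite (mexp_star pi_rep e_units) xx.
Qed.

Let mexp_fix_closed : closed mexp_fix.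
Proof.
move=> x /rnorm_closureP xc; apply/eqP; rewrite -subr_eq0; apply/eqP/rnorm_eq0/le_anti.
rewrite rnorm_ge0 andbT; apply/ler_addgt0Pr => d d0; rewrite add0r.
have [|y /= yy xy] := xc (d / 2); first by rewrite divr_gt0.
rewrite -(subrKA y) -{1}yy -mexpB (le_trans (ler_rnormD _ _))// (splitr d) lerD//.
  by rewrite (le_trans (mexp_contractive pi_rep e_units xi_e xi_dot _))// ltW.
by rewrite rnorm_distC ltW.
Qed.

Definition mexp_subalg : cstar_subalg A := CStarSubalg mexp_fix_star mexp_fix_closed.

Local Notation B := (csub_type mexp_subalg).

Let mexp_mem x : mexp x \in csub_pred mexp_subalg.
Proof. by rewrite csub_predE inE /= /mexp_fix /= (mexp_idem pi_rep e_units xi_e xi_dot). Qed.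

Definition mexp_proj (x : A) : B := CSub (mexp_mem x).

Let mexp_proj_linear : linear mexp_proj.
Proof.
move=> a x y; apply: csub_val_inj.
by rewrite [RHS]csub_valD csub_valZ /= mexp_linear.
Qed.
HB.instance Definition _ := GRing.isLinear.Build R[i] A B _ mexp_proj mexp_proj_linear.

Let mexp_csub (x : B) : mexp (csub_val x) = csub_val x.
Proof. exact: (csub_mem x). Qed.

(** For a positive matrix given by [y], the coefficients of its entries in a block form the Gram
    matrix of the vectors [pi (y p i) (xi k)]. A factor of this Gram matrix whose rows are again
    indexed by pairs in ['I_n * I] can be reread as an [n] by [n] matrix over the algebra, as
    positivity demands. *)
Lemma mexp_proj_cp : completely_positive mexp_proj.
Proof.
move=> n _ [y ->].
have [Z ZP] : exists Z : J -> 'I_n * I -> 'I_n * I -> R[i], forall b i k m l,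
    r k = b -> r l = b ->
    \sum_p hdot (pi (y p m) (xi l)) (pi (y p i) (xi k)) =
    \sum_(c : 'I_n * I | r c.2 == b) Num.conj (Z b c (i, k)) * Z b c (m, l).
  have ZP b : exists Z : 'I_n * I -> 'I_n * I -> R[i], forall i k m l,
      r k = b -> r l = b ->
      \sum_p hdot (pi (y p m) (xi l)) (pi (y p i) (xi k)) =
      \sum_(c : 'I_n * I | r c.2 == b) Num.conj (Z c (i, k)) * Z c (m, l).
    have [Z ZP] := gram_factor [set c : 'I_n * I | r c.2 == b]%SET
      (fun c k => pi (y k c.1) (xi c.2)).
    exists Z => i k m l kb lb.
    rewrite (ZP (i, k) (m, l)) ?finset.inE ?kb ?lb//.
    by apply: eq_bigl => c; rewrite finset.inE.
  have [Z ZP'] := choice ZP.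
  by exists Z => b; exact: ZP'.
(* Row [(p, k)] and column [(i, l)] of the factor of a block become the coefficient of [e k l] in
   the entry [(p, i)]. *)
pose zA p i : A := \sum_k \sum_l Z (r k) (p, k) (i, l) *: e k l.
have zA_mem p i : zA p i \in csub_pred mexp_subalg.
  rewrite csub_predE inE /= /mexp_fix /=; apply: mexp_lspan.
  apply: lspan_sum => k _; apply: lspan_sum => l _.
  by apply/lspanZ/lspan_gen; exists k, l.
exists (\matrix_(p, i) (CSub (zA_mem p i) : B)).
apply/matrixP => i m; rewrite !mxE; apply: csub_val_inj.
rewrite csub_val_sum /=.
under [RHS]eq_bigr => p _ do rewrite !mxE /=.
have -> : \sum_p star (zA p i) ** zA p m =
    \sum_p \sum_h \sum_k \sum_l (Num.conj (Z (r h) (p, h) (i, k)) * Z (r h) (p, h) (m, l)) *: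
      (e k h ** e h l).
  apply: eq_bigr => p _; rewrite /zA star_sum cmul_suml; apply: eq_bigr => h _.
  rewrite star_sum cmul_suml; apply: eq_bigr => k _.
  rewrite starZ (munit_star e_units) cmul_sumr (bigD1 h)//= [X in _ + X]big1 ?addr0.
    rewrite cmul_sumr; apply: eq_bigr => l _.
    by rewrite cmulZl cmulZr scalerA.
  move=> h' hh'; rewrite cmul_sumr big1// => l _.
  by rewrite cmulZl cmulZr (munit_mul0 e_units) ?scaler0// eq_sym.
rewrite pair_bigA /= exchange_big; apply: eq_bigr => k _ /=.
rewrite exchange_big; apply: eq_bigr => l _ /=.
have [kl|kl] := eqVneq (r k) (r l); last first.
  rewrite (munit_off e_units kl) scaler0 big1// => -[p h] _ /=.
  have [kh|kh] := eqVneq (r k) (r h); last by rewrite (munit_off e_units kh) cmul0x scaler0.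
  by rewrite (munit_mul e_units)// (munit_off e_units kl) scaler0.
rewrite /mcoef (rep_sum pi_rep) dot_suml.
under [X in X *: _]eq_bigr => p _ do rewrite (repM pi_rep) (rep_star pi_rep).
rewrite (ZP (r k) i k m l)// scaler_suml big_mkcond; apply: eq_bigr => -[p h] _ /=.
case: eqVneq => [hk|hk]; first by rewrite (munit_mul e_units)// hk.
by rewrite (munit_off e_units) ?cmul0x ?scaler0// eq_sym.
Qed.

Let unitB_mem k l : e k l \in csub_pred mexp_subalg.
Proof. by rewrite csub_predE inE /= /mexp_fix /= (mexp_unit e_units xi_e xi_dot). Qed.
Let unitB k l : B := CSub (unitB_mem k l).

Let mcoef_sum (T : finType) (c : T -> R[i]) (F : T -> A) k l :
  mcoef (\sum_t c t *: F t) k l = \sum_t c t * mcoef (F t) k l.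
Proof.
rewrite /mcoef (rep_sum pi_rep) dot_suml; apply: eq_bigr => t _.
by rewrite (repZ pi_rep) dotZl.
Qed.

Lemma mexp_subalg_fin : finite_dimensional B.
Proof.
(* Units across blocks vanish and cannot enter a basis. *)
pose K := {p : I * I | r p.1 == r p.2}.
exists #|K : finType|; apply: (@has_dim_dual _ _ _ _
  (fun p : K => unitB (val p).1 (val p).2)
  (fun p b => mcoef (csub_val b) (val p).1 (val p).2)) => // [c p|b _].
  rewrite csub_val_sum.
  under eq_bigr => q _ do rewrite csub_valZ.
  rewrite mcoef_sum (bigD1 p)//= big1 ?addr0.
    by rewrite (mcoef_unit xi_e xi_dot)// !eqxx (valP p) mulr1.
  move=> q qp; rewrite (mcoef_unit xi_e xi_dot).
  case: eqVneq => [pq1|_]; last by rewrite mulr0.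
  case: eqVneq => [pq2|_]; last by rewrite mulr0.
  case/eqP: qp; apply: val_inj => /=.
  by rewrite [RHS]surjective_pairing pq1 pq2 -surjective_pairing.
apply: csub_val_inj; rewrite -{1}mexp_csub csub_val_sum /mexp pair_bigA /=.
rewrite (bigID (fun p => r p.1 == r p.2))/= [X in _ + X]big1 ?addr0; last first.
  by move=> p /(munit_off e_units) ->; rewrite scaler0.
rewrite (reindex_omap (val : K -> I * I) insub); last by move=> p rp; rewrite insubT.
by apply: eq_big => [p|p _]; rewrite ?csub_valZ// valK eqxx (valP p).
Qed.

Let diag := [set b : B | forall k l, k != l -> mcoef (csub_val b) k l = 0].

Let diagE (b : B) : diag b ->
  csub_val b = \sum_k mcoef (csub_val b) k k *: e k k.
Proof.
move=> db; rewrite -{1}mexp_csub; apply: eq_bigr => k _.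
by rewrite (bigD1 k)//= big1 ?addr0// => l lk; rewrite db ?scale0r// eq_sym.
Qed.

Let diag_mul (x y : B) : diag x -> diag y -> csub_val (x ** y) =
  \sum_k (mcoef (csub_val x) k k * mcoef (csub_val y) k k) *: e k k.
Proof.
move=> /diagE dx /diagE dy; have -> : csub_val (x ** y) = csub_val x ** csub_val y by [].
rewrite {1}dx {1}dy cmul_suml; apply: eq_bigr => k _; rewrite cmul_sumr (bigD1 k)//= big1 ?addr0.
  by rewrite cmulZl cmulZr scalerA (munit_mul e_units).
by move=> l lk; rewrite cmulZl cmulZr (munit_mul0 e_units) ?scaler0// eq_sym.
Qed.

Let diag_unit k : diag (unitB k k).
Proof.
move=> i j ij; rewrite (mcoef_unit xi_e xi_dot).
by case: eqVneq => //= ik; case: eqVneq => //= jk; move: ij; rewrite ik jk eqxx.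
Qed.

(** For maximality: an element commuting with [e l l] has no coefficient at [(k, l)] with [k != l],
    because [e l l] fixes [xi l] and kills [xi k]. *)
Let diag_masa : is_masa diag.
Proof.
split=> [|x y dx dy|S' _ S'C dS' x S'x k l kl].
- split=> [k l kl|a x y dx dy k l kl|x y dx dy k l kl|x dx k l kl].
  + by rewrite /mcoef (rep0 pi_rep) dot0l.
  + by rewrite csub_valD csub_valZ (mcoefP pi_rep) dx// dy// mulr0 addr0.
  + rewrite (diag_mul dx dy) mcoef_sum big1// => m _.
    by rewrite (diag_unit _ kl) mulr0.
  + by rewrite (mcoef_star pi_rep) dx ?rmorph0// eq_sym.
- apply: csub_val_inj; rewrite diag_mul// diag_mul//.
  by apply: eq_bigr => k _; rewrite mulrC.
have xe : csub_val x ** e l l = e l l ** csub_val x.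
  have /(congr1 (@csub_val _ _ _)) := S'C x (unitB l l) S'x (dS' _ (@diag_unit l)).
  by [].
rewrite /mcoef; have {1}-> : xi l = pi (e l l) (xi l) by rewrite xi_e !eqxx.
rewrite -(repM pi_rep) xe (repM pi_rep) (rep_starr pi_rep) (munit_star e_units).
by rewrite xi_e eq_sym (negbTE kl) dot0r.
Qed.

Lemma mexp_subalg_rank : has_rank B #|I|.
Proof.
exists diag; first exact: diag_masa.
apply: (@has_dim_dual _ _ _ _ (fun k => unitB k k)
  (fun k b => mcoef (csub_val b) k k)) => // [c k|b /diagE db].
  rewrite csub_val_sum.
  under eq_bigr => q _ do rewrite csub_valZ.
  rewrite mcoef_sum (bigD1 k)//= big1 ?addr0.
    by rewrite (mcoef_unit xi_e xi_dot)// !eqxx mulr1.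
  by move=> l lk; rewrite (mcoef_unit xi_e xi_dot) eq_sym (negbTE lk) mulr0.
apply: csub_val_inj; rewrite csub_val_sum {1}db.
by apply: eq_bigr => k _; rewrite csub_valZ.
Qed.

(** The map back is [pi] on the subalgebra, so the error at [x] is [mexp x - x]. As [mexp] fixes [y]
    and is contractive, the error is at most twice the distance from [x] to [y]; hence the bound
    [d / 2]. *)
Lemma mexp_cpa (w : set A) (d : R) :
  (forall x, w x -> exists2 y, lspan [set y | exists i j, y = e i j] y &
     rnorm (x - y) < d / 2) ->
  cpa pi w d #|I|.
Proof.
move=> wd; exists B, mexp_proj, (fun b => pi (csub_val b)); split.
- by split; [exact: mexp_subalg_fin|exact: mexp_subalg_rank].
- split; last exact: mexp_proj_cp.
  by move=> x; rewrite rnorm_csub /= (mexp_contractive pi_rep e_units xi_e xi_dot).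
- split=> [a x y h|b|n x [y ->] h].
  + by rewrite csub_valD csub_valZ (repP pi_rep).
  + apply: opnorm_le => h h1; rewrite (le_trans (rep_contractive pi_rep _ _))//.
    by rewrite ler_piMr ?rnorm_ge0.
  + have -> : \sum_i \sum_j hdot (pi (csub_val ((\matrix_(i0, j0) \sum_k star (y k i0) ** y k j0) i j)) (h j)) (h i) =
      \sum_k hdot (\sum_j pi (csub_val (y k j)) (h j)) (\sum_i pi (csub_val (y k i)) (h i)).
      rewrite [RHS](eq_bigr (fun k => \sum_i \sum_j
        hdot (pi (csub_val (y k j)) (h j)) (pi (csub_val (y k i)) (h i)))).
        rewrite [RHS]exchange_big; apply: eq_bigr => i _ /=.
        rewrite [RHS]exchange_big; apply: eq_bigr => j _ /=.
        rewrite mxE csub_val_sum (rep_sum pi_rep) dot_suml; apply: eq_bigr => k _ /=.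
        by rewrite (repM pi_rep) (rep_star pi_rep).
      move=> k _; rewrite dot_sumr; apply: eq_bigr => i _; exact: dot_suml.
    by apply: sumr_ge0 => k _; exact: dotxx_ge0.
move=> x /wd[y /mexp_lspan yy xy] /=.
(* The operator norm is a supremum, so strictness must come from a bound that is uniform in [h]. *)
apply: (@le_lt_trans _ _ (rnorm (x - y) * 2)%:E); last by rewrite lte_fin -ltr_pdivlMr.
apply: opnorm_le => h h1; rewrite -(repB pi_rep).
apply: le_trans (_ : rnorm (mexp x - x) <= _).
  by rewrite (le_trans (rep_contractive pi_rep _ _))// ler_piMr ?rnorm_ge0.
rewrite -(subrKA y) -{1}yy -mexpB (le_trans (ler_rnormD _ _))// mulr_natr mulr2n.
by rewrite lerD ?(mexp_contractive pi_rep e_units xi_e xi_dot)// rnorm_distC.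
Qed.

End MatrixUnitsApproximation.

(** Indices with [e i i = 0] are dropped, since no unit vector belongs to them. The span does not
    change, as every unit in their row or column is a multiple of [e i i], and the rank can only
    decrease. *)
Lemma matrix_units_cpa (R : realType) (A : cstarAlgType R) (H : hilbertType R)
    (pi : A -> bounded_op H) (I : finType) (J : eqType) (r : I -> J)
    (e : I -> I -> A) (w : set A) (d : R) :
  is_faithful_rep pi -> matrix_units r e ->
  (forall x, w x -> exists2 y, lspan [set y | exists i j, y = e i j] y &
     rnorm (x - y) < d / 2) ->
  exists2 n, (n <= #|I|)%N & cpa pi w d n.
Proof.
move=> pi_rep e_units wd; pose K : finType := {i : I | e i i != 0}.
pose f (i j : K) := e (val i) (val j).
have f_units : matrix_units (r \o val) f.
  split=> [i j|i j|i j k|i j k l jk].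
  - exact: (munit_off e_units).
  - exact: (munit_star e_units).
  - exact: (munit_mul e_units).
  - exact: (munit_mul0 e_units).
have [i|xi [xi_e xi_dot]] := munit_vectors pi_rep f_units; first exact: (valP i).
exists #|K|; first by rewrite card_sub max_card.
apply: (mexp_cpa pi_rep f_units xi_e xi_dot) => x /wd[y ey xy]; exists y => //.
elim: ey => [|a u v [i [j ->]] _ IH]; first exact: lspan0.
have [rij|rij] := eqVneq (r i) (r j); last first.
  by rewrite (munit_off e_units rij) scaler0 add0r.
have [i0|i0] := eqVneq (e i i) 0.
  by rewrite -(munit_mul e_units j (erefl (r i))) i0 cmul0x scaler0 add0r.
have [j0|j0] := eqVneq (e j j) 0.
  by rewrite -(munit_mul e_units j rij) j0 cmulx0 scaler0 add0r.
by apply: lspanD => //; exists (exist _ i i0), (exist _ j j0).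
Qed.

(** * Orthogonal sums and closures of subalgebras *)

(** The squared norm of [pi p0 h] is the sum of those of the [pi (q k) h]. At [h - pi p0 h] the sum
    is zero, which gives [q k] below [p0]; at [pi (q l) h] the term of [l] already exhausts it, so
    the others vanish. *)
Lemma sum_projections (R : realType) (A : cstarAlgType R) (H : hilbertType R)
    (pi : A -> bounded_op H) (K : eqType) (r : seq K) (q : K -> A) (p0 : A) :
  is_faithful_rep pi -> uniq r -> is_projection p0 -> (forall k, is_projection (q k)) ->
  p0 = \sum_(k <- r) q k ->
  (forall k, k \in r -> p0 ** q k = q k) /\
  (forall k l, k \in r -> l \in r -> k != l -> q k ** q l = 0).
Proof.
move=> pi_rep ur [pp sp] qP p0E.
have norm_proj x h : is_projection x -> hdot (pi x h) h = `|pi x h| ^+ 2.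
  by move=> [xx sx]; rewrite normr_hdot -(dot_rep pi_rep) sx xx.
have norm_sum h : `|pi p0 h| ^+ 2 = \sum_(k <- r) `|pi (q k) h| ^+ 2.
  rewrite -norm_proj// {1}p0E (rep_sum pi_rep) dot_suml.
  by apply: eq_bigr => k _; exact: norm_proj.
have p0q k : k \in r -> p0 ** q k = q k.
  move=> kr; have [qq sq] := qP k.
  suff : q k ** p0 = q k by move/(congr1 star); rewrite starM sp sq.
  apply/esym/eqP; rewrite -subr_eq0; apply/eqP; apply: (rep_eq0 pi_rep) => h.
  rewrite (repB pi_rep) (repM pi_rep) -linearB/=.
  have /eqP := norm_sum (h - pi p0 h).
  have -> : pi p0 (h - pi p0 h) = 0 by rewrite linearB/= -(repM pi_rep) pp subrr.
  rewrite normr0 expr0n/= eq_sym.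
  rewrite big_seq psumr_eq0; last by move=> l _; rewrite exprn_ge0.
  move=> /allP/(_ k kr); rewrite kr sqrf_eq0 normr_eq0 => /eqP; exact.
split=> // k l kr lr kl; apply: (rep_eq0 pi_rep) => h; rewrite (repM pi_rep).
have /eqP := norm_sum (pi (q l) h).
rewrite -(repM pi_rep) p0q// (bigD1_seq l)//= -(repM pi_rep); have [-> _] := qP l.
rewrite -subr_eq0 opprD addrA subrr add0r oppr_eq0 big_seq_cond psumr_eq0; last first.
  by move=> m _; rewrite exprn_ge0.
by move=> /allP/(_ k kr); rewrite kr kl/= sqrf_eq0 normr_eq0 => /eqP.
Qed.

Section OrthogonalSum.
Context {R : realType} {A : cstarAlgType R} {K : eqType}.
Implicit Types (r : seq K).

Let sum_sq (a : K -> A) r : uniq r -> (forall k l, k != l -> a k ** a l = 0) ->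
  (\sum_(k <- r) a k) ** (\sum_(k <- r) a k) = \sum_(k <- r) a k ** a k.
Proof.
move=> ur a0; rewrite cmul_suml big_seq [RHS]big_seq; apply: eq_bigr => k kr.
rewrite cmul_sumr (bigD1_seq k)//= big1 ?addr0// => l lk.
by rewrite a0// eq_sym.
Qed.

Let csq_sum (a : K -> A) r n : uniq r -> (forall k l, k != l -> a k ** a l = 0) ->
  csq n (\sum_(k <- r) a k) = \sum_(k <- r) csq n (a k) /\
  forall k l, k != l -> csq n (a k) ** csq n (a l) = 0.
Proof.
move=> ur a0; elim: n => [//|n [IH IH0]] /=; split; first by rewrite IH sum_sq.
by move=> k l kl; rewrite -cmulA [X in _ ** X]cmulA IH0// cmul0x cmulx0.
Qed.

(** The powers of [star z ** z], for the sum [z], are sums of the powers of the orthogonal [a k].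
    The triangle inequality loses the factor [size r], which [ler_pow2_limit] removes. *)
Lemma rnorm_orthogonal_sum (z : K -> A) r (M : R) : uniq r -> 0 <= M ->
  (forall k l, k != l -> star (z k) ** z l = 0) ->
  (forall k l, k != l -> z k ** star (z l) = 0) ->
  (forall k, rnorm (z k) <= M) -> rnorm (\sum_(k <- r) z k) <= M.
Proof.
move=> ur M0 z1 z2 zM; pose a k := star (z k) ** z k.
have a0 k l : k != l -> a k ** a l = 0.
  by move=> kl; rewrite /a -cmulA [X in _ ** X]cmulA z2// cmul0x cmulx0.
have aE : star (\sum_(k <- r) z k) ** (\sum_(k <- r) z k) = \sum_(k <- r) a k.
  rewrite star_sum cmul_suml big_seq [RHS]big_seq; apply: eq_bigr => k kr.
  rewrite cmul_sumr (bigD1_seq k)//= big1 ?addr0// => l lk.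
  by rewrite z1// eq_sym.
rewrite -(@ler_pXn2r _ 2)// ?nnegrE ?rnorm_ge0// -rnorm_cstar aE.
have sa k : star (a k) = a k by rewrite starM starK.
apply: (ler_pow2_limit (C := (size r)%:R)); rewrite ?rnorm_ge0 ?exprn_ge0// => n.
rewrite -rnorm_csq; last by rewrite star_sum; apply: eq_bigr.
have [-> _] := csq_sum n ur a0; rewrite (le_trans (ler_rnorm_sum _ _ _))//.
rewrite mulr_natl -iter_addr_0 -(count_predT r) -big_const_seq ler_sum// => k _.
rewrite rnorm_csq// lerXn2r ?nnegrE ?rnorm_ge0 ?exprn_ge0//.
by rewrite rnorm_cstar lerXn2r ?nnegrE ?rnorm_ge0.
Qed.

End OrthogonalSum.

Lemma cstar_gen_sub (R : realType) (A : cstarAlgType R) (G : set A) (x : A) :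
  G x -> csubset (cstar_gen G) x.
Proof. by move=> Gx S [_ _]; exact. Qed.

Lemma cstar_gen_ind (R : realType) (A : cstarAlgType R) (G S : set A) (x : A) :
  is_star_subalg S -> closed S -> G `<=` S -> csubset (cstar_gen G) x -> S x.
Proof. by move=> Ss Sc GS; apply. Qed.

Lemma closure_star_subalg (R : realType) (A : cstarAlgType R) (S : set A) :
  is_star_subalg S -> is_star_subalg (closure S).
Proof.
move=> [S0 SD SM Sstar].
have approx x y d : closure S x -> closure S y -> 0 < d ->
    exists u v, [/\ S u, S v, rnorm (x - u) < d & rnorm (y - v) < d].
  move=> /rnorm_closureP cx /rnorm_closureP cy d0.
  by have [u Su xu] := cx d d0; have [v Sv yv] := cy d d0; exists u, v.
split=> [|a x y Sx Sy|x y Sx Sy|x Sx].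
- exact: subset_closure.
- apply/rnorm_closureP => d d0; set c := complex.Re `|a|.
  have c0 : 0 < c + 1 by rewrite ltr_wpDl// -ler0c /c RRe_real ?normr_real.
  have [|u [v [Su Sv xu yv]]] := approx x y (d / (c + 1)) Sx Sy; first by rewrite divr_gt0.
  exists (a *: u + v); first exact: SD.
  rewrite opprD addrACA -scalerBr (le_lt_trans (ler_rnormD _ _))// rnormZ -/c.
  have -> : d = c * (d / (c + 1)) + d / (c + 1).
    by rewrite -[X in _ + X]mul1r -mulrDl mulrC divfK// gt_eqF.
  by rewrite ler_ltD// ler_wpM2l ?(ltW xu)// -ler0c /c RRe_real ?normr_real.
- apply/rnorm_closureP => d d0; set M := rnorm x + rnorm y + 1.
  have M0 : 0 < M by rewrite ltr_wpDl// addr_ge0 ?rnorm_ge0.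
  (* The bound [1] keeps [rnorm u] at most [M]; the other one makes each of the two terms of the
     error at most [d / 2]. *)
  pose d' := Num.min 1 (d / (M + M)).
  have [|u [v [Su Sv xu yv]]] := approx x y d' Sx Sy.
    by rewrite lt_min ltr01 divr_gt0// addr_gt0.
  exists (u ** v); first exact: SM.
  have -> : x ** y - u ** v = (x - u) ** y + u ** (y - v).
    by rewrite cmulBl cmulBr subrKA.
  rewrite (le_lt_trans (ler_rnormD _ _))//.
  have /andP[d1 d2] : (d' <= 1) && (d' <= d / (M + M)) by rewrite -le_min.
  have -> : d = d / (M + M) * M + M * (d / (M + M)).
    have M2 : M + M != 0 by rewrite gt_eqF// addr_gt0.
    by rewrite [X in _ = _ + X]mulrC -mulrDr divfK.
  rewrite ler_ltD//.
    rewrite (le_trans (rnorm_cmul _ _))// ler_pM ?rnorm_ge0//.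
      by rewrite (le_trans (ltW xu)).
    by rewrite /M -addrA addrCA lerDl addr_ge0 ?rnorm_ge0.
  apply: (@le_lt_trans _ _ (rnorm u * rnorm (y - v))); first exact: rnorm_cmul.
  apply: (@le_lt_trans _ _ (M * rnorm (y - v))); last first.
    by rewrite ltr_pM2l// (lt_le_trans yv).
  rewrite ler_wpM2r ?rnorm_ge0// -(subKr x u) (le_trans (ler_rnormB _ _))//.
  by rewrite /M -addrA lerD2l ler_wpDl ?rnorm_ge0// (le_trans (ltW xu)).
- apply/rnorm_closureP => d d0; have [u [_ [Su _ xu _]]] := approx x x d Sx Sx d0.
  by exists (star u); [exact: Sstar|rewrite -starB rnorm_star].
Qed.

(** * Local finiteness and the Cuntz-Krieger relations *)

Lemma in_out_edges (E : digraph) (v : vertex E) (e : edge E) :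
  locally_finite E -> (e \in fset_set (out_edges v)) = (src e == v).
Proof.
move=> lf; rewrite in_fset_set; last by case: (lf v).
by apply/idP/eqP; rewrite in_setE.
Qed.

Lemma in_in_edges (E : digraph) (v : vertex E) (e : edge E) :
  locally_finite E -> (e \in fset_set (in_edges v)) = (tgt e == v).
Proof.
move=> lf; rewrite in_fset_set; last by case: (lf v).
by apply/idP/eqP; rewrite in_setE.
Qed.

(** From a sink [v] only [v] can be reached, so irreducibility leaves one vertex and no edge, a
    finite graph. *)
Lemma infinite_out_edges (E : digraph) (v : vertex E) :
  irreducible E -> infinite_graph E -> out_edges v !=set0.
Proof.
move=> irr inf; apply/set0P/negP => /eqP v0; apply: inf.
have vE w : w = v.
  have [[u [|e a] ea] [/= uv <-]] := irr v w; first by rewrite /ptgt /= uv.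
  have /= /andP[/eqP eu _] := ea; have ev : src e = v by rewrite eu.
  by have : out_edges v e by []; rewrite v0.
split; first by rewrite (_ : setT = [set v])//; apply/seteqP; split=> // w _; exact: vE.
rewrite (_ : setT = set0)//; apply/seteqP; split=> // e _.
by rewrite -v0; exact: vE.
Qed.

Section CuntzKrieger.
Context {R : realType} {E : digraph} {A : cstarAlgType R}.
Variables (p : vertex E -> A) (s : edge E -> A).
Hypothesis ck : cuntz_krieger A p s.
Hypothesis lf : locally_finite E.
Hypothesis no_sink : forall v : vertex E, out_edges v !=set0.
Local Notation core := (gauge_core p s).
Context {H : hilbertType R} (pi : csub_type core -> bounded_op H).
Hypothesis pi_rep : is_faithful_rep pi.

Implicit Types (v w : vertex E) (e f : edge E) (a b : seq (edge E)).

Lemma ck_pp v : p v ** p v = p v. Proof. by case: ck => -[/(_ v)[]]. Qed.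
Lemma ck_pstar v : star (p v) = p v. Proof. by case: ck => -[/(_ v)[]]. Qed.
Lemma ck_p0 v w : v != w -> p v ** p w = 0.
Proof. by case: ck => -[_ p0] _ _ _ _ /eqP; exact: p0. Qed.
Lemma ck_sss e : s e ** star (s e) ** s e = s e.
Proof. by case: ck => _ /(_ e). Qed.
Lemma ck_ss e : star (s e) ** s e = p (tgt e).
Proof. by case: ck => _ _ /(_ e). Qed.
Lemma ck_sp e : s e ** p (tgt e) = s e.
Proof. by rewrite -ck_ss cmulA ck_sss. Qed.
Lemma ck_sum v : p v = \sum_(e <- fset_set (out_edges v)) s e ** star (s e).
Proof.
case: ck => _ _ _ _ /(_ v); have [fo _] := lf v.
by move=> /(_ fo (no_sink v)) ->; rewrite fsbig_finite.
Qed.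

Let path_core (a b : gpath E) : plen a = plen b ->
  csubset core (path_elt p s a ** star (path_elt p s b)).
Proof. by move=> ab; apply: cstar_gen_sub; exists a, b. Qed.

Let p_core v : csubset core (p v).
Proof.
have vP : @is_path E v [::] by [].
by have := @path_core (GPath vP) (GPath vP) erefl; rewrite /path_elt /= ck_pstar ck_pp.
Qed.

Let q_core e : csubset core (s e ** star (s e)).
Proof.
have eP : @is_path E (src e) [:: e] by rewrite /= eqxx.
exact: (@path_core (GPath eP) (GPath eP) erefl).
Qed.

Let q_proj e : is_projection (s e ** star (s e)).
Proof. by split; rewrite ?starM ?starK// cmulA ck_sss. Qed.

(** [sum_projections] is applied to the relation for [p (src e)]. All the projections involved lie
    in the core, where the faithful representation is available. *)
Let ck_q e : p (src e) ** (s e ** star (s e)) = s e ** star (s e) /\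
  forall f, src e = src f -> e != f -> s e ** star (s e) ** (s f ** star (s f)) = 0.
Proof.
pose P := CSub (mem_set (p_core (src e))) : csub_type core.
pose Q f := CSub (mem_set (q_core f)) : csub_type core.
have PP : is_projection P.
  by split; apply: csub_val_inj; [exact: ck_pp|exact: ck_pstar].
have QP f : is_projection (Q f).
  by have [qq sq] := q_proj f; split; apply: csub_val_inj; [exact: qq|exact: sq].
have PE : P = \sum_(f <- fset_set (out_edges (src e))) Q f.
  by apply: csub_val_inj; rewrite csub_val_sum; exact: ck_sum.
have [PQ QQ] := sum_projections pi_rep (fset_uniq _) PP QP PE.
have er : e \in fset_set (out_edges (src e)) by rewrite in_out_edges.
split=> [|f ef nef]; first exact: (congr1 (@csub_val _ _ _) (PQ e er)).
have fr : f \in fset_set (out_edges (src e)) by rewrite in_out_edges// ef.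
exact: (congr1 (@csub_val _ _ _) (QQ e f er fr nef)).
Qed.

Lemma ck_ps e : p (src e) ** s e = s e.
Proof. by rewrite -{1}ck_sss cmulA; have [-> _] := ck_q e; rewrite ck_sss. Qed.

Lemma ck_ps0 v e : v != src e -> p v ** s e = 0.
Proof. by move=> ve; rewrite -ck_ps cmulA ck_p0// cmul0x. Qed.

Lemma ck_orth e f : e != f -> star (s e) ** s f = 0.
Proof.
move=> ef; have [sef|sef] := eqVneq (src e) (src f); last first.
  rewrite -(ck_ps e) starM ck_pstar -cmulA ck_ps0 ?cmulx0//.
rewrite -(ck_sss e) -(ck_sss f) starM starM starK.
have [_ /(_ f sef ef) q0] := ck_q e.
have -> : star (s e) ** (s e ** star (s e)) ** (s f ** star (s f) ** s f) =
  star (s e) ** ((s e ** star (s e)) ** (s f ** star (s f))) ** s f.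
  by rewrite !cmulA.
by rewrite q0 cmulx0 cmul0x.
Qed.

Lemma rnorm_edge e : rnorm (s e) <= 1.
Proof.
rewrite -(@ler_pXn2r _ 2)// ?nnegrE ?rnorm_ge0// -rnorm_cstar ck_ss expr1n.
have [->//|p0] := eqVneq (rnorm (p (tgt e))) 0.
have := rnorm_cstar (p (tgt e)); rewrite ck_pstar ck_pp expr2 => /eqP.
by rewrite -{1}[rnorm _]mulr1 (inj_eq (mulfI p0)) => /eqP <-.
Qed.

Definition edge_sum (F : seq (edge E)) x := \sum_(e <- F) s e ** x ** star (s e).

(** The terms have mutually orthogonal ranges and supports. The bound is uniform in [F], which is
    what makes the net of partial sums converge on the core. *)
Lemma edge_sum_contractive F x : uniq F -> rnorm (edge_sum F x) <= rnorm x.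
Proof.
move=> uF; apply: rnorm_orthogonal_sum => //.
- exact: rnorm_ge0.
- move=> e f ef; rewrite !starM starK -!cmulA [X in _ ** (_ ** X)]cmulA.
  by rewrite [X in _ ** (_ ** X)]cmulA ck_orth// !cmul0x !cmulx0.
- move=> e f ef; rewrite !starM starK -!cmulA [X in _ ** (_ ** X)]cmulA.
  by rewrite ck_orth// cmul0x !cmulx0.
move=> e; rewrite (le_trans (rnorm_cmul _ _))// rnorm_star -[leRHS]mulr1.
rewrite ler_pM ?rnorm_ge0 ?rnorm_edge// (le_trans (rnorm_cmul _ _))//.
by rewrite ler_piMl ?rnorm_ge0 ?rnorm_edge.
Qed.

Lemma edge_sumB F x y : edge_sum F (x - y) = edge_sum F x - edge_sum F y.
Proof.
by rewrite /edge_sum -sumrB; apply: eq_bigr => e _; rewrite cmulBr cmulBl.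
Qed.

End CuntzKrieger.

#[local] Existing Instance summability.totally_filter.

(** * Paths described by their end point *)

Section PathsTo.
Variable E : digraph.
Implicit Types (v w : vertex E) (e f : edge E) (a b : seq (edge E)).

(** Paths are anchored at their end [v], because [PhiE] prepends edges and leaves the end
    unchanged. *)
Definition path_src a v := if a is e :: _ then src e else v.

Fixpoint path_to a v : bool :=
  if a is e :: a' then (tgt e == path_src a' v) && path_to a' v else true.

Lemma path_toP a v :
  path_to a v = is_path (path_src a v) a && (last (path_src a v) (map tgt a) == v).
Proof.
elim: a => [|e a IH] /=; first by rewrite eqxx.
rewrite eqxx /= IH; case: a {IH} => [|f a]/=; first by rewrite eqxx andbT.
by rewrite eqxx [tgt e == _]eq_sym andbA.
Qed.

Lemma path_to_gpath a v : path_to a v ->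
  exists g : gpath E, pedges g = a /\ ptgt g = v.
Proof. by rewrite path_toP => /andP[av /eqP vE]; exists (GPath av). Qed.

Lemma gpath_path_to (g : gpath E) :
  path_to (pedges g) (ptgt g) /\ path_src (pedges g) (ptgt g) = psrc g.
Proof.
case: g => v a av; rewrite /ptgt /=.
have -> : path_src a (last v (map tgt a)) = v.
  by case: a av => [|e a]//= /andP[/eqP].
split=> //; rewrite path_toP.
have -> : path_src a (last v (map tgt a)) = v.
  by case: a av => [|e a]//= /andP[/eqP].
by rewrite av eqxx.
Qed.

Lemma path_to_cat a b v :
  path_to (a ++ b) v = path_to a (path_src b v) && path_to b v.
Proof.
elim: a => //= e a ->; rewrite andbA; congr (_ && _ && _).
by case: a.
Qed.

Lemma path_src_cat a b v : path_src (a ++ b) v = path_src a (path_src b v).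
Proof. by case: a. Qed.

(* The end point v of a path a is recorded because a may be empty. *)
Definition paths_through i m (V : seq (vertex E)) : set (seq (edge E) * vertex E) :=
  [set c | [/\ path_to c.1 c.2, size c.1 = (i + m)%N & path_src (drop i c.1) c.2 \in V]].

Lemma paths_through_cons i m V e a v : paths_through i m V (a, v) ->
  tgt e = path_src a v -> paths_through i.+1 m V (e :: a, v).
Proof. by move=> [/= av sa aV] ea; split=> //=; rewrite ?ea ?eqxx ?sa. Qed.

Lemma paths_through_rcons i m V e a v : paths_through i m V (a, v) ->
  src e = v -> paths_through i m.+1 V (rcons a e, tgt e).
Proof.
move=> [/= av sa aV] ev; split=> /=.
- by rewrite -cats1 path_to_cat /= ev av eqxx.
- by rewrite size_rcons sa addnS.
- rewrite -cats1 drop_cat; case: ltnP => [_|ia]; first by rewrite path_src_cat /= ev.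
  (* The marked vertex is here the end point [v], which is the source of the appended edge. *)
  have m0 : m = 0%N by apply/eqP; rewrite -leqn0 -(leq_add2l i) -sa addn0.
  rewrite sa m0 addn0 subnn /= ev; move: aV.
  by rewrite drop_oversize// sa m0 addn0.
Qed.

Lemma paths_through_sub i m V V' c :
  {subset V <= V'} -> paths_through i m V c -> paths_through i m V' c.
Proof. by move=> VV' [? ? /VV' ?]; split. Qed.

End PathsTo.

(** * Path elements, approximation in the core, and iterates of the map *)

Section PathElements.
Context {R : realType} {E : digraph} {A : cstarAlgType R}.
Variables (p : vertex E -> A) (s : edge E -> A).
Hypothesis ck : cuntz_krieger A p s.
Hypothesis lf : locally_finite E.
Hypothesis no_sink : forall v : vertex E, out_edges v !=set0.
Local Notation core := (gauge_core p s).
Context {H : hilbertType R} (pi : csub_type core -> bounded_op H).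
Hypothesis pi_rep : is_faithful_rep pi.

Implicit Types (v w : vertex E) (e f : edge E) (a b : seq (edge E)).
Implicit Types (c d : seq (edge E) * vertex E) (V : seq (vertex E)).

Let ps e : p (src e) ** s e = s e := ck_ps ck lf no_sink pi_rep e.
Let ps0 v e : v != src e -> p v ** s e = 0 := @ck_ps0 _ _ _ _ _ ck lf no_sink _ _ pi_rep v e.
Let orth e f : e != f -> star (s e) ** s f = 0 := @ck_orth _ _ _ _ _ ck lf no_sink _ _ pi_rep e f.

(** With the projection at the end of the product, empty paths are treated uniformly and prepending
    an edge is multiplication by [s e]. For sequences that are not paths the product is zero. *)
Definition path_to_elt c := foldr (fun e y => s e ** y) (p c.2) c.1.

Local Notation t := path_to_elt.

Lemma path_to_elt_src v c : p v ** t c = if v == path_src c.1 c.2 then t c else 0.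
Proof.
case: c => -[|e a] w /=; case: eqVneq => [->|vw].
- exact: (ck_pp ck).
- exact: (ck_p0 ck).
- by rewrite cmulA ps.
- by rewrite cmulA ps0// cmul0x.
Qed.

Lemma path_to_elt_tgt v c : t c ** p v = if c.2 == v then t c else 0.
Proof.
case: c => a w; rewrite /t /=; elim: a => [|e a IH] /=; last first.
  by rewrite -cmulA IH; case: ifP; rewrite ?cmulx0.
by case: eqVneq => [->|vw]; [exact: (ck_pp ck)|exact: (ck_p0 ck)].
Qed.

Lemma path_to_elt0 c : ~~ path_to c.1 c.2 -> t c = 0.
Proof.
case: c => a v; elim: a => [//|e a IH] /=.
rewrite negb_and => /orP[ea|/IH /= at0]; last by rewrite /t /= -/(t (a, v)) at0 cmulx0.
rewrite /t /= -/(t (a, v)) -(ck_sp ck) -cmulA path_to_elt_src /=.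
by rewrite (negbTE ea) cmulx0.
Qed.

Lemma path_to_elt_norm c : path_to c.1 c.2 -> star (t c) ** t c = p c.2.
Proof.
case: c => a v; elim: a => [|e a IH] /=.
  by move=> _; rewrite /t /= (ck_pstar ck) (ck_pp ck).
move=> /andP[/eqP ea /IH /= av]; rewrite /t /= -/(t (a, v)) starM -cmulA.
by rewrite [X in _ ** X]cmulA (ck_ss ck) ea path_to_elt_src eqxx.
Qed.

Lemma path_to_elt_orth c d : size c.1 = size d.1 -> c != d -> star (t c) ** t d = 0.
Proof.
case: c d => a v [b w] /=; elim: a b => [|e a IH] [|f b]//=.
  by move=> _ vw; rewrite /t /= (ck_pstar ck) (ck_p0 ck)//; apply: contra vw => /eqP ->.
move=> [ab] cd; rewrite /t /= -/(t (a, v)) -/(t (b, w)) starM -cmulA.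
rewrite [X in _ ** X]cmulA; have [ef|ef] := eqVneq e f; last by rewrite orth// cmul0x cmulx0.
rewrite -ef (ck_ss ck) path_to_elt_src; case: ifP => _; last by rewrite cmulx0.
by apply: IH => //; apply: contra cd => /eqP[-> ->]; rewrite ef.
Qed.

Lemma path_to_elt_rcons a e : t (rcons a e, tgt e) = t (a, src e) ** s e.
Proof.
rewrite /t /=; elim: a => [|f a IH] /=; first by rewrite (ck_sp ck) ps.
by rewrite IH cmulA.
Qed.

(** The multiplication table of matrix units whose blocks are the end points of paths of a common
    length. *)
Lemma path_to_elt_unit c d k l : size c.1 = size d.1 -> path_to c.1 c.2 ->
  (t k ** star (t c)) ** (t d ** star (t l)) =
  if (c == d) && (k.2 == c.2) then t k ** star (t l) else 0.
Proof.
move=> cd cP; have [<-|cd'] := eqVneq c d; last first.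
  rewrite -cmulA [X in _ ** X]cmulA path_to_elt_orth// cmul0x cmulx0//.
rewrite -cmulA [X in _ ** X]cmulA path_to_elt_norm// cmulA path_to_elt_tgt /=.
by case: ifP => //; rewrite cmul0x.
Qed.

Lemma path_to_elt_off c d : c.2 != d.2 -> t c ** star (t d) = 0.
Proof.
move=> cd; have <- : t d ** p d.2 = t d by rewrite path_to_elt_tgt eqxx.
by rewrite starM (ck_pstar ck) cmulA path_to_elt_tgt (negbTE cd) cmul0x.
Qed.

Lemma path_eltE (g : gpath E) : path_elt p s g = t (pedges g, ptgt g).
Proof.
case: g => v [|e a] av; rewrite /path_elt /ptgt /t//=.
have foldE x y b : foldl (fun x f => x ** s f) x b ** y =
    x ** foldr (fun f y => s f ** y) y b.
  by elim: b x => //= f b IH x; rewrite IH cmulA.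
rewrite -foldE; case/lastP: a {av} => [|a f]; first by rewrite /= (ck_sp ck).
by rewrite -cats1 foldl_cat /= map_cat last_cat /= -cmulA (ck_sp ck).
Qed.

Lemma path_to_elt_core c d : size c.1 = size d.1 -> csubset core (t c ** star (t d)).
Proof.
have [core0 _ _ _] := csub_star core.
have [cP|cP] := boolP (path_to c.1 c.2); last by rewrite (path_to_elt0 cP) cmul0x.
have [dP|dP] := boolP (path_to d.1 d.2); last by rewrite (path_to_elt0 dP) star0 cmulx0.
case: c d cP dP => a v [b w] /= /path_to_gpath[g [<- <-]] /path_to_gpath[h [<- <-]] gh.
by apply: cstar_gen_sub; exists g, h; rewrite !path_eltE.
Qed.

Definition path_units i m V : set A :=
  [set x | exists c d, [/\ paths_through i m V c, paths_through i m V d &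
     x = t c ** star (t d)]].

Local Notation L i m V := (lspan (path_units i m V)).

Lemma path_units_core i m V x : L i m V x -> csubset core x.
Proof.
have [core0 coreD _ _] := csub_star core.
elim=> // a u v [c [d [[_ cs _] [_ ds _] ->]]] _ IH; apply: coreD => //.
by apply: path_to_elt_core; rewrite cs ds.
Qed.

Lemma path_units_sub i m V V' x : {subset V <= V'} -> L i m V x -> L i m V' x.
Proof.
move=> VV'; apply: lspan_sub => y [c [d [cP dP ->]]]; apply: lspan_gen.
by exists c, d; split=> //; exact: paths_through_sub VV' _.
Qed.

(** Between the two factors, [p v] at the common end is replaced by the sum of [s e ** star (s e)]
    over the edges leaving it, which extends both paths by [e] and keeps the vertex after [i]
    steps. *)
Lemma path_unitsS i m V x : L i m V x -> L i m.+1 V x.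
Proof.
apply: lspan_sub => y [[a v] [[b w] [cP dP ->]]].
have [vw|vw] := eqVneq v w; last by rewrite path_to_elt_off//; exact: lspan0.
rewrite -{}vw in dP *.
have <- : t (a, v) ** p v = t (a, v) by rewrite path_to_elt_tgt eqxx.
rewrite (ck_sum ck lf no_sink) cmul_sumr cmul_suml big_seq.
apply: lspan_sum => e; rewrite in_out_edges// => /eqP ev.
rewrite cmulA -ev -path_to_elt_rcons -cmulA -starM -path_to_elt_rcons.
apply: lspan_gen; exists (rcons a e, tgt e), (rcons b e, tgt e).
split=> //; [exact: paths_through_rcons cP ev|exact: paths_through_rcons dP ev].
Qed.

Lemma path_units_le i m n V x : (m <= n)%N -> L i m V x -> L i n V x.
Proof.
move=> mn Lx; rewrite -(subnKC mn); elim: (n - m)%N => [|k IH]; first by rewrite addn0.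
by rewrite addnS; exact: path_unitsS.
Qed.

(** An edge contributes to a unit only if it ends at the source of the first path. There are
    finitely many such edges, so the partial sums are eventually constant. *)
Lemma path_units_edge_sum i m V y : L i m V y ->
  exists (F0 : {fset edge E}) y', L i.+1 m V y' /\
    forall F : {fset edge E}, (F0 `<=` F)%fset -> edge_sum s F y = y'.
Proof.
elim=> [|k u v [[a x] [[b z] [cP dP ->]]] _ [F0 [y' [y'L F0y']]]].
  exists fset0, 0; split; first exact: lspan0.
  by move=> F _; rewrite /edge_sum big1// => e _; rewrite cmulx0 cmul0x.
pose F1 := fset_set (in_edges (path_src a x)).
have term0 e : e \notin F1 -> s e ** (t (a, x) ** star (t (b, z))) ** star (s e) = 0.
  rewrite in_in_edges// => ea; rewrite -(ck_sp ck e) [X in X ** star _]cmulA -[s e ** p _ ** _]cmulA.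
  by rewrite path_to_elt_src /= (negbTE ea) cmulx0 !cmul0x.
exists (F1 `|` F0)%fset, (k *: edge_sum s F1 (t (a, x) ** star (t (b, z))) + y'); split.
  apply: lspanP => //; rewrite /edge_sum big_seq; apply: lspan_sum => e.
  rewrite in_in_edges// => /eqP ea.
  have -> : s e ** (t (a, x) ** star (t (b, z))) ** star (s e) =
    t (e :: a, x) ** star (t (e :: b, z)) by rewrite /t /= starM !cmulA.
  (* The two paths may start at different vertices; an edge which fits only the first gives zero. *)
  have [eb|eb] := eqVneq (tgt e) (path_src b z).
    apply: lspan_gen; exists (e :: a, x), (e :: b, z).
    by split=> //; exact: paths_through_cons.
  have -> : t (e :: b, z) = 0 by apply: path_to_elt0; rewrite /= (negbTE eb).
  by rewrite star0 cmulx0; exact: lspan0.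
move=> F; rewrite fsubUset => /andP[F1F F0F]; rewrite -(F0y' F F0F) /edge_sum.
have -> : \sum_(e <- F1) s e ** (t (a, x) ** star (t (b, z))) ** star (s e) =
    \sum_(e <- F) s e ** (t (a, x) ** star (t (b, z))) ** star (s e).
  by apply: big_fset_incl => // e _ /term0.
rewrite scaler_sumr -big_split; apply: eq_bigr => e _ /=.
by rewrite cmulDr cmulDl cmulZr cmulZl.
Qed.

Lemma path_units_mul m V x y : L 0 m V x -> L 0 m V y -> L 0 m V (x ** y).
Proof.
move=> xL yL; elim: xL => [|k u v uG _ IH]; first by rewrite cmul0x; exact: lspan0.
rewrite cmulDl cmulZl; apply: lspanP => //; elim: yL => [|l u' v' u'G _ IH'].
  by rewrite cmulx0; exact: lspan0.
rewrite cmulDr cmulZr; apply: lspanP => //.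
case: uG u'G => c [d [cP dP ->]] [c' [d' [c'P d'P ->]]].
rewrite path_to_elt_unit; last by case: dP.
  by case: ifP => _; [apply: lspan_gen; exists c, d'|exact: lspan0].
by case: dP => _ -> _; case: c'P => _ ->.
Qed.

Lemma path_units_star i m V x : L i m V x -> L i m V (star x).
Proof.
elim=> [|k u v [c [d [cP dP ->]]] _ IH]; first by rewrite star0; exact: lspan0.
rewrite starD starZ; apply: lspanD => //; exists d, c; split=> //.
by rewrite starM starK.
Qed.

(** Two spans lie in a common one, for the larger length and the joined vertex lists. Their union is
    thus a self-adjoint subalgebra, and its closure contains the generators of the core. *)
Lemma core_approx x : csubset core x -> forall eps : R, 0 < eps ->
  exists m V y, L 0 m V y /\ rnorm (x - y) < eps.
Proof.
pose D := [set x | exists m V, L 0 m V x].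
have D_common u z : D u -> D z -> exists m V, L 0 m V u /\ L 0 m V z.
  move=> [m [V uL]] [n [W zL]]; exists (maxn m n), (V ++ W); split.
    apply: (path_units_le (leq_maxl _ _)); apply: path_units_sub uL => ?.
    by rewrite mem_cat => ->.
  apply: (path_units_le (leq_maxr _ _)); apply: path_units_sub zL => ?.
  by rewrite mem_cat orbC => ->.
have D_star : is_star_subalg D.
  split=> [|a u z uD zD|u z uD zD|u [m [V uL]]].
  - by exists 0%N, [::]; exact: lspan0.
  - by have [m [V [uL zL]]] := D_common u z uD zD; exists m, V; exact: lspanP.
  - by have [m [V [uL zL]]] := D_common u z uD zD; exists m, V; exact: path_units_mul.
  - by exists m, V; exact: path_units_star.
move=> xc; suff /rnorm_closureP xD : closure D x.
  by move=> eps eps0; have [y [m [V yL]] xy] := xD eps eps0; exists m, V, y.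
apply: cstar_gen_ind xc; first exact: closure_star_subalg.
  exact: closed_closure.
move=> _ [g [h [gh ->]]]; apply: subset_closure; exists (plen g), [:: psrc g; psrc h].
rewrite !path_eltE; apply: lspan_gen.
have [gP gs] := gpath_path_to g; have [hP hs] := gpath_path_to h.
exists (pedges g, ptgt g), (pedges h, ptgt h).
by split=> //; split=> //=; rewrite drop0 ?gs ?hs ?inE ?eqxx ?orbT.
Qed.

Let partial_sumE x : partial_sum (fun e => s e ** x ** star (s e)) = (fun F => edge_sum s F x).
Proof. by apply/funext => F; rewrite /partial_sum /edge_sum big_seq_fsetE. Qed.

Let edge_sum_near i m V x y : L i m V y -> exists2 y', L i.+1 m V y' &
  \forall F \near totally, rnorm (y' - edge_sum s (F : {fset edge E}) x) <= rnorm (x - y).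
Proof.
move=> /path_units_edge_sum[F0 [y' [y'L F0y']]]; exists y' => //.
exists F0 => // F /= /F0y' <-; rewrite rnorm_distC -edge_sumB.
exact: (edge_sum_contractive ck lf no_sink pi_rep _ (fset_uniq _)).
Qed.

(** The partial sums at a nearby [y] are eventually constant, and by uniform contractivity those at
    [x] stay close to them, hence form a Cauchy net. *)
Let PhiE_cvg x : csubset core x ->
  (fun F : {fset edge E} => edge_sum s F x) @ totally --> PhiE s x.
Proof.
move=> xc; rewrite /PhiE /summability.sum partial_sumE.
apply: rnorm_cauchy_cvg => eps eps0.
have [m [V [y [yL xy]]]] := core_approx xc eps0.
have [y' _ y'F] := edge_sum_near x yL; exists y'; apply: filterS y'F => F h.
exact: le_lt_trans xy.
Qed.

Lemma PhiE_approx x i m V y : csubset core x -> L i m V y ->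
  exists2 y', L i.+1 m V y' & rnorm (PhiE s x - y') <= rnorm (x - y).
Proof.
move=> xc yL; have [y' y'L y'F] := edge_sum_near x yL; exists y' => //.
apply/ler_addgt0Pr => eps eps0.
have xF := (cvg_rnormP (F := @totally (edge E)) _ _).1 (PhiE_cvg xc) _ eps0.
have [F [h1 h2]] := filter_ex (filterI y'F (xF filter_filter)).
rewrite -(subrKA (edge_sum s F x)) (le_trans (ler_rnormD _ _))// addrC lerD ?(ltW h2)//.
by rewrite rnorm_distC.
Qed.

Lemma PhiE_core x : csubset core x -> csubset core (PhiE s x).
Proof.
move=> xc; apply: (@csub_closed _ _ core); apply/rnorm_closureP => eps eps0.
have [m [V [y [yL xy]]]] := core_approx xc eps0.
have [y' /path_units_core y'c xy'] := PhiE_approx xc yL.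
by exists y' => //; exact: le_lt_trans xy.
Qed.

(** Errors do not accumulate, since [PhiE_approx] never increases the distance. By [PhiE_core] the
    restriction never takes its default value. *)
Lemma iter_PhiE_approx (x : csub_type core) i m V y : L 0 m V y ->
  exists2 y', L i m V y' &
    rnorm (csub_val (iter i (csub_restrict core (PhiE s)) x) - y') <= rnorm (csub_val x - y).
Proof.
move=> yL; elim: i => [|i [y' y'L h]]; first by exists y.
set z := iter i _ x in h *.
have zc : csubset core (csub_val z) := csub_mem z.
have [y'' y''L h'] := PhiE_approx zc y'L; exists y'' => //.
rewrite iterS -/z /csub_restrict -[csub_val _]/(val _) insubdK; last exact: (mem_set (PhiE_core zc)).
exact: le_trans h.
Qed.

End PathElements.

(** * Counting paths through given vertices *)

Lemma finite_paths_from (E : digraph) (u : vertex E) n :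
  locally_finite E -> finite_set (paths_from u n).
Proof.
move=> lf; elim: n u => [|n IH] u.
  by apply: (@sub_finite_set _ _ [set [::]]) => // a [_ /size0nil].
apply: (@sub_finite_set _ _
  (\bigcup_(e in out_edges u) [set e :: a | a in paths_from (tgt e) n])).
  by move=> [|e a] [//= /andP[/eqP eu ea] [an]]; exists e => //; exists a.
apply: bigcup_finite; first by case: (lf u).
by move=> e _; exact: finite_image.
Qed.

Lemma locally_finite_rev (E : digraph) : locally_finite E -> locally_finite (rev_graph E).
Proof. by move=> lf v; have [? ?] := lf v. Qed.

Definition num_paths (E : digraph) (u : vertex E) n := #|` fset_set (paths_from u n)|.

Lemma is_path_rcons (E : digraph) (u : vertex E) a e :
  is_path u (rcons a e) = is_path u a && (src e == last u (map tgt a)).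
Proof.
elim: a u => [|f a IH] u /=; first by rewrite andbT.
by rewrite IH andbA.
Qed.

Lemma path_to_rev (E : digraph) (a : seq (edge E)) (u : vertex E) :
  path_to a u -> @is_path (rev_graph E) u (rev a).
Proof.
elim: a => //= e a IH /andP[/eqP ea /IH au].
rewrite rev_cons is_path_rcons au /= ea; case: a {IH au ea} => //= f a.
by rewrite map_rev rev_cons last_rcons.
Qed.

Section PathCount.
Variable E : digraph.
Hypothesis lf : locally_finite E.

(** Paths are cut at the marked vertex [u], the first piece being read backwards. Repetitions are
    harmless, as the list serves for an upper bound. *)
Definition enum_through i m (V : seq (vertex E)) : seq (seq (edge E) * vertex E) :=
  flatten [seq [seq (rev (b : seq (edge E)) ++ a, last u (map tgt a)) |
    b <- fset_set (@paths_from (rev_graph E) u i), a <- fset_set (paths_from u m)] | u <- V].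

Lemma size_enum_through i m V : size (enum_through i m V) =
  \sum_(u <- V) @num_paths (rev_graph E) u i * num_paths u m.
Proof.
rewrite /enum_through size_flatten sumnE /shape !big_map; apply: eq_bigr => u _.
by rewrite size_allpairs.
Qed.

Lemma mem_enum_through i m V c : paths_through i m V c -> c \in enum_through i m V.
Proof.
case: c => a v [/= av sa aV]; set u := path_src (drop i a) v in aV.
move: av; rewrite -{1}(cat_take_drop i a) path_to_cat -/u => /andP[ta].
rewrite path_toP -/u => /andP[da /eqP vE].
have si : size (take i a) = i by rewrite size_takel// sa leq_addr.
apply/flattenP; eexists; first by apply/mapP; exists u.
apply/allpairsP; exists (rev (take i a), drop i a); split=> /=.
- rewrite in_fset_set; last exact: (finite_paths_from _ _ (locally_finite_rev lf)).
  by rewrite in_setE; split; [exact: path_to_rev|rewrite size_rev].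
- rewrite in_fset_set; last exact: finite_paths_from.
  by rewrite in_setE; split=> //; rewrite size_drop sa addKn.
- by rewrite revK cat_take_drop vE.
Qed.

End PathCount.

(** * Approximation of finite pieces of orbits *)

Section OrbitApproximation.
Context {R : realType} {E : digraph} {A : cstarAlgType R}.
Variables (p : vertex E -> A) (s : edge E -> A).
Hypothesis ck : cuntz_krieger A p s.
Hypothesis lf : locally_finite E.
Hypothesis no_sink : forall v : vertex E, out_edges v !=set0.
Local Notation core := (gauge_core p s).
Context {H : hilbertType R} (pi : csub_type core -> bounded_op H).
Hypothesis pi_rep : is_faithful_rep pi.
Local Notation t := (path_to_elt p s).

Let finite_core_approx (w : set (csub_type core)) (d : R) : finite_set w -> 0 < d ->
  exists m V, forall x, w x -> exists2 y, lspan (path_units p s 0 m V) y &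
    rnorm (csub_val x - y) < d.
Proof.
move=> /finite_seqP[r ->] d0; elim: r => [|x r [m [V rV]]].
  by exists 0%N, [::].
have [n [W [y [yL xy]]]] := core_approx ck lf no_sink pi_rep (csub_mem x) d0.
exists (maxn m n), (V ++ W) => z; rewrite /= inE => /predU1P[->|/rV[y' y'L zy']].
  exists y => //; apply: (path_units_le ck lf no_sink pi_rep (leq_maxr _ _)).
  by apply: path_units_sub yL => ?; rewrite mem_cat orbC => ->.
exists y' => //; apply: (path_units_le ck lf no_sink pi_rep (leq_maxl _ _)).
by apply: path_units_sub y'L => ?; rewrite mem_cat => ->.
Qed.

(** The common length [N] is what makes the elements multiply as matrix units. The list [S] is first
    cleared of repetitions and of entries that are not paths of length [N]. *)
Let path_units_cpa (S : seq (seq (edge E) * vertex E)) (N : nat)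
    (w : set (csub_type core)) (d : R) :
  (forall x, w x -> exists2 y,
     lspan [set z | exists c c', [/\ c \in S, c' \in S, path_to c.1 c.2 /\ size c.1 = N,
       path_to c'.1 c'.2 /\ size c'.1 = N & z = t c ** star (t c')]] y &
     rnorm (csub_val x - y) < d / 2) ->
  exists2 r, (r <= size S)%N & cpa pi w d r.
Proof.
move=> wd; pose S' := undup [seq c <- S | path_to c.1 c.2 && (size c.1 == N)].
pose I : finType := seq_sub S'.
have IP (i : I) : path_to (val i).1 (val i).2 /\ size (val i).1 = N.
  by have := valP i; rewrite mem_undup mem_filter => /andP[/andP[? /eqP ?]].
have IN (i j : I) : size (val i).1 = size (val j).1.
  by have [_ ->] := IP i; have [_ ->] := IP j.
pose u (i j : I) : csub_type core :=
  CSub (mem_set (@path_to_elt_core _ _ _ _ _ ck lf no_sink _ _ pi_rep _ _ (IN i j))).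
have u_units : matrix_units (fun i : I => (val i).2) u.
  split=> [i j ij|i j|i j k ij|i j k l jk]; apply: csub_val_inj => /=.
  - exact: (path_to_elt_off ck).
  - by rewrite starM starK.
  - have [jP _] := IP j.
    by rewrite (path_to_elt_unit ck lf no_sink pi_rep)// eqxx ij eqxx.
  - have [jP _] := IP j.
    rewrite (path_to_elt_unit ck lf no_sink pi_rep _ _ (IN j k))//.
    by move: jk; rewrite -val_eqE /= => /negbTE ->.
have [|r rI wr] := matrix_units_cpa (d := d) (w := w) pi_rep u_units; last first.
  exists r => //; rewrite (leq_trans rI)// card_seq_sub ?undup_uniq//.
  by rewrite (leq_trans (size_undup _))// size_filter count_size.
move=> x /wd[y yS xy].
suff [z zu zy] : exists2 z, lspan [set z | exists i j, z = u i j] z & csub_val z = y.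
  by exists z => //; rewrite rnorm_csub csub_valB zy.
elim: yS => [|a b y' [c [c' [cS c'S [cP cN] [c'P c'N] ->]]] _ [z zu zy]].
  by exists 0 => //; exact: lspan0.
have cS' : c \in S' by rewrite mem_undup mem_filter cP cN eqxx.
have c'S' : c' \in S' by rewrite mem_undup mem_filter c'P c'N eqxx.
exists (a *: u (SeqSub cS') (SeqSub c'S') + z).
  by apply: lspanD => //; exists (SeqSub cS'), (SeqSub c'S').
by rewrite csub_valD csub_valZ zy.
Qed.

(** [m] and [V] depend on [w] and [d] alone. The [i]-th iterates involve paths of length [i + m];
    extending these by [n - i] edges puts all iterates into the same algebra. *)
Lemma orbit_cpa (w : set (csub_type core)) (d : R) : finite_set w -> 0 < d ->
  exists m (V : seq (vertex E)), forall n, exists2 r,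
    (r <= \sum_(i < n) \sum_(u <- V)
       @num_paths (rev_graph E) u i * @num_paths E u (m + (n - i)))%N &
    cpa pi (orbit_upto (csub_restrict core (PhiE s)) w n) d r.
Proof.
move=> fw d0; have [|m [V wV]] := @finite_core_approx w (d / 2) fw; first by rewrite divr_gt0.
exists m, V => n.
pose S := flatten [seq enum_through i (m + (n - i)) V | i : 'I_n].
have SE : size S = (\sum_(i < n) \sum_(u <- V)
       @num_paths (rev_graph E) u i * @num_paths E u (m + (n - i)))%N.
  rewrite /S size_flatten sumnE /shape !big_map -enumT big_enum; apply: eq_bigr => i _.
  exact: size_enum_through.
have [|r rS wr] := @path_units_cpa S (m + n)
  (orbit_upto (csub_restrict core (PhiE s)) w n) d; last first.
  by exists r => //; rewrite -SE.
move=> _ [i /= i_n [x wx <-]].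
have [y yL xy] := wV x wx.
have [z zL xz] := iter_PhiE_approx ck lf no_sink pi_rep x i yL.
exists z; last exact: le_lt_trans xy.
have := path_units_le ck lf no_sink pi_rep (leq_addr (n - i) m) zL.
have iN : (i + (m + (n - i)) = m + n)%N by rewrite addnCA subnKC// ltnW.
apply: lspan_sub => _ [c [c' [cP c'P ->]]]; apply: lspan_gen; exists c, c'.
have mS b : paths_through i (m + (n - i)) V b -> b \in S.
  move=> /(mem_enum_through lf) bi; apply/flattenP.
  by exists (enum_through i (m + (n - i)) V) => //; apply/mapP; exists (Ordinal i_n); rewrite ?mem_enum.
split=> //; try exact: mS.
  by case: cP => ? ->.
by case: c'P => ? ->.
Qed.

End OrbitApproximation.

(** * Growth rates *)

Lemma is_path_cat (E : digraph) (u : vertex E) a b :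
  is_path u (a ++ b) = is_path u a && is_path (last u (map tgt a)) b.
Proof. by elim: a u => //= e a IH u; rewrite IH andbA. Qed.

Lemma irreducible_rev (E : digraph) : irreducible E -> irreducible (rev_graph E).
Proof.
move=> irr v w; have [g [gw gv]] := irr w v.
have [gP gs] := gpath_path_to g; rewrite gv gw in gP gs.
have rP := path_to_rev gP; exists (GPath rP); split=> //.
rewrite /ptgt /= -gs; case: (pedges g) => // e a.
by rewrite map_rev rev_cons last_rcons.
Qed.

(** Prepending a fixed path from [v] to [u] is injective. This carries a growth bound from one
    vertex to all those of [V]. *)
Lemma num_paths_le (E : digraph) (u v : vertex E) : locally_finite E -> irreducible E ->
  exists k, forall n, (num_paths u n <= num_paths v (k + n))%N.
Proof.
move=> lf irr; have [g [gv gu]] := irr v u; exists (plen g) => n.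
rewrite /num_paths -(size_map (cat (pedges g))); apply: uniq_leq_size.
  by rewrite map_inj_uniq ?fset_uniq// => a b /eqP; rewrite eqseq_cat// eqxx => /eqP.
move=> _ /mapP[a + ->]; rewrite !in_fset_set ?in_setE; try exact: finite_paths_from.
move=> [ua sa]; split; last by rewrite size_cat sa.
by rewrite is_path_cat -gv (gpathP g)/= -/(ptgt g) gu.
Qed.

Section Growth.
Context {R : realType}.

Lemma limn_esup_le (u : (\bar R)^nat) (x : \bar R) N :
  (forall n, (N <= n)%N -> (u n <= x)%E) -> (limn_esup u <= x)%E.
Proof.
move=> ux; apply: (@le_trans _ _ (ereal_sup (u @` [set n | (N <= n)%N]))).
  by apply: ereal_inf_lbound; exists [set n | (N <= n)%N] => //; exists N.
by apply: ge_ereal_sup => _ [n Nn <-]; exact: ux.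
Qed.

Lemma limn_esup_lt (u : (\bar R)^nat) (x : \bar R) :
  (limn_esup u < x)%E -> exists N, forall n, (N <= n)%N -> (u n <= x)%E.
Proof.
move=> /ereal_inf_lt[_ [S [N _ NS] <-]] Sx; exists N => n Nn.
by apply: (le_trans _ (ltW Sx)); apply: ereal_sup_ubound; exists n => //; exact: NS.
Qed.

Lemma lee_lneW (x y : \bar R) : (x <= y)%E -> (lne x <= lne y)%E.
Proof.
move=> xy; have [x0|x0] := leP x 0%E; first by rewrite le0_lneNy// leNye.
by rewrite lee_lne// in_itv/= leey andbT ltW// (lt_le_trans x0).
Qed.

Lemma block_entropy_lt (E : digraph) (v : vertex E) (c : R) : locally_finite E ->
  (block_entropy E v < c%:E)%E ->
  exists K : R, 0 <= K /\ forall n, (num_paths v n)%:R <= K * expR (c * n%:R).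
Proof.
move=> lf /limn_esup_lt[N Nc].
(* The summand [1] serves for [n > N], where the entropy bound needs no constant; the sum covers the
   finitely many other [n], among them [0]. *)
pose K : R := 1 + \sum_(n < N.+1) (num_paths v n)%:R / expR (c * n%:R).
have K1 : 1 <= K by rewrite lerDl sumr_ge0// => n _; rewrite divr_ge0 ?expR_ge0.
exists K; split=> [|n]; first by rewrite (le_trans _ K1).
have [nN|Nn] := leqP n N.
  rewrite -ler_pdivrMr ?expR_gt0// /K (bigD1 (Ordinal (nN : (n < N.+1)%N)))//= addrCA lerDl.
  by rewrite addr_ge0// sumr_ge0// => i _; rewrite divr_ge0 ?expR_ge0.
apply: (@le_trans _ _ (expR (c * n%:R))); last by rewrite ler_peMl ?expR_ge0.
have n0 : 0 < n%:R :> R by rewrite ltr0n (leq_ltn_trans _ Nn).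
have := Nc n (ltnW Nn); rewrite lee_pdivrMl// /counting asboolT; last exact: finite_paths_from.
rewrite -/(num_paths v n) /=; case: ifPn => [h _|]; first by rewrite (le_trans h)// expR_ge0.
rewrite -ltNge => h; rewrite -EFinM lee_fin mulrC => hc.
by rewrite -[leLHS]lnK ?posrE// ler_expR.
Qed.

Lemma num_paths_growth (E : digraph) (v u : vertex E) (c : R) :
  locally_finite E -> irreducible E -> (block_entropy E v < c%:E)%E ->
  exists K : R, 0 <= K /\ forall n, (num_paths u n)%:R <= K * expR (c * n%:R).
Proof.
move=> lf irr /(block_entropy_lt lf)[K [K0 vK]].
have [k uv] := num_paths_le u v lf irr.
exists (K * expR (c * k%:R)); split=> [|n]; first by rewrite mulr_ge0 ?expR_ge0.
rewrite -mulrA -expRD -mulrDr -natrD; apply: le_trans (vK (k + n)%N).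
by rewrite ler_nat.
Qed.

Lemma limn_esup_growth (x : (\bar R)^nat) (c K : R) : 0 <= K ->
  (forall n, (x n <= (n%:R * K * expR (c * n%:R))%:E)%E) ->
  (limn_esup (fun n => (n%:R^-1)%:E * lne (x n)) <= c%:E)%E.
Proof.
move=> K0 xK; apply/lee_addgt0Pr => eps eps0; pose d := eps / 2.
have d0 : 0 < d by rewrite divr_gt0.
(* As [n * d <= expR (n * d)], the factor [n * K] is at most [expR (n * d) * M]; the other half of
   [eps] absorbs [M] once [N <= n]. With [K + 1], [M] is positive even for [K = 0]. *)
pose M := (K + 1) / d; have M0 : 0 < M by rewrite divr_gt0// ltr_wpDl.
pose N := (Num.truncn (`|ln M| / d)).+1.
have nN n : (N <= n)%N -> ln M <= n%:R * d.
  move=> Nn; rewrite (le_trans (ler_norm _))// -ler_pdivrMr//.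
  by rewrite (le_trans (ltW (truncnS_gt _)))// ler_nat.
apply: (@limn_esup_le _ _ N) => n Nn.
have n0 : 0 < n%:R :> R by rewrite ltr0n (leq_trans _ Nn).
rewrite lee_pdivrMl// (le_trans (lee_lneW (xK n)))//.
apply: (@le_trans _ _ (lne (expR (n%:R * (c + eps)))%:E)); last first.
  by rewrite lne_EFin ?expR_gt0// expRK -EFinD -EFinM.
apply: lee_lneW; rewrite lee_fin.
have -> : n%:R * (c + eps) = n%:R * d + n%:R * d + c * n%:R.
  by rewrite /d -mulrDr -splitr mulrDr addrC mulrC [c * _]mulrC.
rewrite !expRD ler_wpM2r ?expR_ge0//.
apply: (@le_trans _ _ (expR (n%:R * d) * M)); last first.
  by rewrite ler_wpM2l ?expR_ge0// -[leLHS]lnK ?posrE// ler_expR nN.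
rewrite /M mulrCA mulrC ler_pM ?ler0n//; first by rewrite lerDl.
by rewrite ler_pdivlMr// (le_trans _ (expR_ge1Dx _))// lerDr.
Qed.

End Growth.

(** Growth bounds have real exponents, while entropies may be infinite; for [y = -oo], all real [c]
    bound [x]. *)
Lemma lee_real_gt (R : realType) (x y : \bar R) :
  (forall c : R, (y < c%:E)%E -> (x <= c%:E)%E) -> (x <= y)%E.
Proof.
case: y => [y| |] xc; [|exact: leey|].
  by apply/lee_addgt0Pr => e e0; apply: xc; rewrite lte_fin ltrDl.
case: x xc => [x| |]// xc.
  by have := xc (x - 1) (ltNyr _); rewrite lee_fin leNgt ltrBlDr ltrDl ltr01.
by have := xc 0 (ltNyr _).
Qed.

Local Open Scope ereal_scope.

Theorem theorem3p9 (R : realType) (E : digraph)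
    (Eirr : irreducible E) (Elf : locally_finite E) (Einf : infinite_graph E)
    (A : cstarAlgType R) (p : vertex E -> A) (s : edge E -> A)
    (A_CE : is_graph_cstar_algebra p s)
    (H : hilbertType R) (pi : csub_type (gauge_core p s) -> bounded_op H)
    (pi_faithful : is_faithful_rep pi)
    (v w : vertex E) :
  ht pi (csub_restrict (gauge_core p s) (PhiE s)) <=
    maxe (block_entropy (rev_graph E) v) (block_entropy E w).
Proof.
have [ck _ _] := A_CE; have no_sink u := infinite_out_edges u Eirr Einf.
apply: ge_ereal_sup => _ [S fS <-]; apply: ge_ereal_sup => _ [d /= d0 <-].
(* Being strictly above both entropies, [c] turns each of them into an exponential bound on path
   numbers. *)
apply: lee_real_gt => c; rewrite gt_max => /andP[vc wc].
have [m [V SV]] := orbit_cpa ck Elf no_sink pi_faithful fS d0.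
have [Ka KaP] := choice (fun u => num_paths_growth u
  (locally_finite_rev Elf) (irreducible_rev Eirr) vc).
have [Kb KbP] := choice (fun u => num_paths_growth u Elf Eirr wc).
apply: (@limn_esup_growth _ _ _ (\sum_(u <- V) Ka u * Kb u * expR (c * m%:R))%R) => [|n].
  by apply: sumr_ge0 => u _; rewrite !mulr_ge0 ?expR_ge0 ?(KaP u).1 ?(KbP u).1.
have [r rn Sr] := SV n; apply: (@le_trans _ _ r%:R%:E).
  by apply: ereal_inf_lbound; exists r.
rewrite lee_fin; apply: (@le_trans _ _ (\sum_(i < n) \sum_(u <- V)
    @num_paths (rev_graph E) u i * @num_paths E u (m + (n - i)))%N%:R).
  by rewrite ler_nat.
rewrite natr_sum -[X in (_ <= X%:R * _ * _)%R](card_ord n) -sumr_const !mulr_suml.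
apply: ler_sum => i _; rewrite natr_sum mul1r mulr_suml.
apply: ler_sum => u _.
have [Ka0 Kan] := KaP u; have [Kb0 Kbn] := KbP u.
rewrite natrM; apply: (le_trans (ler_pM _ _ (Kan i) (Kbn (m + (n - i))%N))) => //.
(* The exponents [c * i] and [c * (m + (n - i))] add up to [c * m + c * n]; the first part sits in
   the constant, so the [n] summands share one bound. *)
rewrite mulrACA -!mulrA -!expRD -!mulrDr -!natrD.
by rewrite addnCA subnKC// ltnW.
Qed.
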